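(* Let $K$ be an infinite field of characteristic $p>2$, let $\lambda=(\lambda_1,\dots,\lambda_n)$, $\mu=(\mu_1,\dots,\mu_n)$ be partitions of $n$ and let $k,d$ be positive integers. If $p^d >\min\{\lambda_2, \mu_1-\lambda_1\}$ and $\mu_2\le \lambda_1$, then \[\Hom_{\mathfrak{S}_n}(S^{\mu}, S^{\lambda})\simeq \Hom_{\mathfrak{S}_{n'}}(S^{\mu^+}, S^{\lambda^+}),\] where $n'=n+kp^{d}$, $\lambda^+ =\lambda+(kp^{d})$ and $\mu^+=\mu+(kp^{d})$.
   Context: For a partition $\lambda$ of $n$, $S^{\lambda}$ denotes the Specht module corresponding to $\lambda$ for the group algebra $K\mathfrak{S}_n$ of the symmetric group $\mathfrak{S}_n$ (as defined in Green's book ''Polynomial representations of $GL_n$''). For a partition $\lambda=(\lambda_1,\dots,\lambda_n)$ and a nonnegative integer $m$, $\lambda+(m)$ denotes the partition $(\lambda_1+m,\lambda_2,\dots,\lambda_n)$. *)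

(* Defs.v *)
From HB Require Import structures.
From mathcomp Require Import all_boot all_order all_algebra all_fingroup.
From mathcomp Require Import mxrepresentation.
Set Implicit Arguments. Unset Strict Implicit. Unset Printing Implicit Defensive.
Import GRing.Theory.
Local Open Scope ring_scope.

(* Partitions.  A partition of n is a weakly decreasing list of natural *)
(* numbers summing to n (trailing zeros allowed); lambda_i is           *)
(* nth 0 lambda (i-1).                                                  *)
Definition is_partition (n : nat) (la : seq nat) : bool :=
  sorted geq la && (sumn la == n).

Definition add_first (m : nat) (la : seq nat) : seq nat :=
  if la is a :: l then (a + m)%N :: l else [:: m].

(* Row functions ("tabloids"): t x is the row in which the number x    *)
(* lies.  All functions 'I_n -> 'I_n.+1 are used as a basis of an      *)
(* ambient permutation module; M^lambda is the span of those with row  *)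
(* sizes lambda, and the Specht module lives inside it.                *)
Definition rowfun (n : nat) := {ffun 'I_n -> 'I_n.+1}.

(* right action of 'S_n (mathcomp: (s * t) x = t (s x)): number x moves
   to s x, so the new row function is t o s^-1. *)
Definition tact n (t : rowfun n) (s : 'S_n) : rowfun n := [ffun x => t (s^-1%g x)].

Definition dimW n := #|rowfun n|.

Definition tmx (K : fieldType) n (s : 'S_n) : 'M[K]_(dimW n) :=
  \matrix_(i, j) ((tact (enum_val i) s == enum_val j)%:R).

Arguments tmx K n s : clear implicits.

Lemma tactM n (t : rowfun n) (s u : 'S_n) : tact t (s * u)%g = tact (tact t s) u.
Proof. by apply/ffunP => x; rewrite !ffunE invMg permM. Qed.

Lemma tact1 n (t : rowfun n) : tact t 1%g = t.
Proof. by apply/ffunP => x; rewrite ffunE invg1 perm1. Qed.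

Lemma tmx_repr (K : fieldType) n : mx_repr [set: 'S_n] (tmx K n).
Proof.
split=> [|s u _ _].
  apply/matrixP => i j; rewrite !mxE tact1.
  by rewrite (inj_eq enum_val_inj).
apply/matrixP => i j; rewrite !mxE tactM.
rewrite (bigD1 (enum_rank (tact (enum_val i) s))) //= !mxE enum_rankK eqxx mul1r.
rewrite big1 ?addr0 // => k nk; rewrite !mxE.
case: eqP => [ek|]; last by rewrite mul0r.
by move: nk; rewrite ek => /eqP[]; apply: enum_val_inj; rewrite enum_rankK.
Qed.

Definition tabloid_repr (K : fieldType) n : mx_representation K [set: 'S_n] (dimW n) :=
  MxRepresentation (tmx_repr K n).

Definition tvec (K : fieldType) n (t : rowfun n) : 'rV[K]_(dimW n) :=
  delta_mx 0 (enum_rank t).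
Arguments tvec K {n} t.

(* The initial lambda-tableau T0: numbers 0..n-1 written row by row. *)
Definition rowof (la : seq nat) (x : nat) : nat :=
  \sum_(i < size la) (\sum_(j < i.+1) nth 0 la j <= x)%N.
Definition colof (la : seq nat) (x : nat) : nat :=
  (x - \sum_(j < rowof la x) nth 0 la j)%N.

Definition row0 (la : seq nat) n : rowfun n := [ffun x : 'I_n => inord (rowof la x)].

Definition colstab (la : seq nat) n : {set 'S_n} :=
  [set s : 'S_n | [forall x : 'I_n, colof la (s x) == colof la x]].

Definition polytab (K : fieldType) (la : seq nat) n : 'rV[K]_(dimW n) :=
  \sum_(s in colstab la n) ((-1) ^+ (odd_perm s)) *: tvec K (tact (row0 la n) s).

(* The Specht module S^lambda: the K S_n-submodule of M^lambda spanned by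
   the polytabloids (= the cyclic submodule generated by e_{T0}, since
   e_{T0} s = e_{T0 s} and every lambda-tableau is T0 s). *)
Definition specht_mx (K : fieldType) (la : seq nat) n :=
  cyclic_mx (tabloid_repr K n) (polytab K la n).

Definition specht (K : fieldType) (la : seq nat) n :
  mx_representation K [set: 'S_n] (\rank (specht_mx K la n)) :=
  submod_repr (cyclic_mx_module (tabloid_repr K n) (polytab K la n)).

Definition homspace (K : fieldType) (gT : finGroupType) (G : {group gT}) a b
    (rU : mx_representation K G a) (rV : mx_representation K G b)
    : {vspace 'M[K]_(a, b)} :=
  (\bigcap_(g in G) lker (linfun (fun A : 'M[K]_(a, b) => rU g *m A - A *m rV g)))%VS.

Definition dimHom (K : fieldType) n (mu la : seq nat) : nat :=
  \dim (homspace (specht K mu n) (specht K la n)).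

(* Main.v *)
Require Import Defs.
From HB Require Import structures.
From mathcomp Require Import all_boot all_order all_algebra all_fingroup.
From mathcomp Require Import mxrepresentation zify.
Set Implicit Arguments. Unset Strict Implicit. Unset Printing Implicit Defensive.
Import GRing.Theory.
Local Open Scope ring_scope.

(** A homomorphism S^mu -> S^la is determined by the image of a polytabloid,
    that is by a function [v] on the fillings [f] of the diagram of mu.  The
    Garnir relations and the kernel intersection theorem are one statement
    ([psi_altsum]), applied to columns for mu and to rows for la; they say which
    [v] occur: [v] alternates along the columns of mu, satisfies the Garnir
    relations of mu, has weight la, and is killed by the maps replacing b entries
    [i+1] by [i].  (Rows, hence entries, are numbered from 0.)

    Since 2 is invertible, [v] vanishes on fillings with two 0s in a column.  As
    mu_2 <= la_1, at least m of the single-box columns of the diagram of mu + (m)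
    are therefore filled with 0 whenever a value is non-zero, and deleting m such
    boxes identifies the functions for (mu + (m), la + (m)) with those for
    (mu, la).  Only the condition for [i = 0] changes, the coefficients
    'C(t, w) becoming 'C(t + m, w).  For m = k p^d these agree modulo p when
    w < p^d, and for w >= p^d they multiply values on fillings with w single-box
    columns filled with 1, which vanish because w > min(la_2, mu_1 - la_1). *)


(** * Fillings and exchange conditions *)

(** The numbers below n label the boxes of mu and are also the points being permuted, so a row
    tabloid of M^la is literally a filling of mu: box x holds the row in which x lies. A permutation
    [g] is read as the tableau with [g x] in box x; composing [r] and [c] with the inverse of [g]
    gives its row and column tabloids. A vector lies in a Specht module exactly when its coefficient
    at a row tabloid is a signed sum, over the tableaux with that row tabloid, of a function of the
    column tabloid. A function on the translates of a polytabloid extends linearly exactly when it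
    is a signed sum, over the tableaux with a given column tabloid, of a function of the row
    tabloid. Transposing the diagram interchanges the two descriptions, which is why one theorem
    serves both. The obstacle is that the relations for mu + (m) also involve fillings from which m
    zeros cannot be deleted, where the lifted function is 0. The critical case is a tail of
    single-box columns with exactly m zeros: then mu_2 <= la_1 forces a 0 into every other column,
    and this zero rescues the relation. *)

Notation filling n := {ffun 'I_n -> nat}.
Notation sgp K g := ((-1) ^+ (odd_perm g) : K).

Definition precomp n (f : filling n) (g : 'S_n) : filling n := [ffun x => f (g x)].
Definition upd n (U : filling n) (Z : {set 'I_n}) (a : nat) : filling n :=
  [ffun x => if x \in Z then a else U x].

Lemma precompM n (f : filling n) g h : precomp f (g * h)%g = precomp (precomp f h) g.
Proof. by apply/ffunP => x; rewrite !ffunE permM. Qed.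

Lemma precomp1 n (f : filling n) : precomp f 1%g = f.
Proof. by apply/ffunP => x; rewrite !ffunE perm1. Qed.

Lemma precompK n (f : filling n) g : precomp (precomp f g) g^-1%g = f.
Proof. by rewrite -precompM mulVg precomp1. Qed.

Lemma precompKV n (f : filling n) g : precomp (precomp f g^-1%g) g = f.
Proof. by rewrite -precompM mulgV precomp1. Qed.

Lemma sgpM (K : fieldType) n (g h : 'S_n) : sgp K (g * h)%g = sgp K g * sgp K h.
Proof. by rewrite odd_permM signr_addb. Qed.

Lemma sgpV (K : fieldType) n (g : 'S_n) : sgp K (g^-1)%g = sgp K g.
Proof. by rewrite odd_permV. Qed.

Lemma sgp_tperm (K : fieldType) n (x y : 'I_n) : x != y -> sgp K (tperm x y) = -1.
Proof. by move=> nxy; rewrite odd_tperm nxy expr1. Qed.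

Lemma sgp_sqr (K : fieldType) n (g : 'S_n) : sgp K g * sgp K g = 1.
Proof. by rewrite -expr2 sqrr_sign. Qed.

Lemma eq_opp0 (K : fieldType) (x : K) : (2%:R : K) != 0 -> x = - x -> x = 0.
Proof.
move=> two /eqP; rewrite -addr_eq0 -mulr2n -mulr_natl mulf_eq0 (negPf two) /=.
by move/eqP.
Qed.

(** The left side is the coefficient at [U] of the image of [F] under the map sending a filling to
    the sum of all fillings got by turning b entries [j'] into [j]. For [j' = j.+1] these are
    James's maps, whose common kernel is the Specht module. *)
Definition psi_at (K : fieldType) n (F : filling n -> K) (j j' : nat) :=
  forall (U : filling n) (b : nat), (0 < b)%N ->
  \sum_(Z : {set 'I_n} | (Z \subset [set x | U x == j]) && (#|Z| == b))
     F (upd U Z j') = 0.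

(** With A = c and B = r the sum runs over the tableaux with column tabloid [h] and evaluates [w] at
    their row tabloids; with A = r and B = c it gives the coefficients of a combination of
    polytabloids. *)
Definition altsum (K : fieldType) n (A B : filling n) (w : filling n -> K)
    (h : filling n) : K :=
  \sum_(g : 'S_n | precomp h g == A) sgp K g * w (precomp B g^-1%g).

(* [r x] and [c x] are the row and the column of the box labelled [x]. *)
Record diagram n (r c : filling n) : Prop := Diagram {
  diag_inj : forall x y, r x = r y -> c x = c y -> x = y;
  diag_left : forall x j, (j < c x)%N -> exists2 y, r y = r x & c y = j;
  diag_up : forall x i, (i < r x)%N -> exists2 y, c y = c x & r y = i }.

Lemma diagram_sym n (r c : filling n) : diagram r c -> diagram c r.
Proof. by case=> i l u; split=> // x y *; apply: i. Qed.

Section Altsum.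
Variables (K : fieldType) (n : nat) (r c : filling n).
Hypotheses (two : (2%:R : K) != 0) (D : diagram r c).

(* A box of column j' filled from column j is swapped with its row neighbour  *)
(* in column j: this preserves the row function and reverses the sign.        *)
Lemma altsum_psi w j j' : (j < j')%N -> psi_at (altsum (K := K) c r w) j j'.
Proof.
move=> ltjj U b b_gt0.
pose P (X : {set 'I_n}) (g : 'S_n) :=
  (#|X| == b) && [forall y, if y \in X then (c y == j') && (U (g y) == j)
                            else U (g y) == c y].
(* [Z] is a set of numbers, [X] the set of boxes holding them. The swap takes place between boxes,
   so the sum is reorganised with [X] fixed. *)
transitivity (\sum_(X : {set 'I_n}) \sum_(g | P X g) sgp K g * w (precomp r g^-1%g)).
  rewrite /altsum big_mkcond /=.
  transitivity (\sum_(Z : {set 'I_n}) \sum_(g : 'S_n | P (g @^-1: Z) g)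
                   sgp K g * w (precomp r g^-1%g)).
    apply: eq_bigr => Z _.
    have eP (g : 'S_n) : P (g @^-1: Z) g =
       ((Z \subset [set x | U x == j]) && (#|Z| == b)) && (precomp (upd U Z j') g == c).
      rewrite /P card_preimset; last exact: perm_inj.
      rewrite -andbA andbCA; congr andb; apply/forallP/andP.
        move=> H; split.
          apply/subsetP => y yZ; have := H (g^-1%g y).
          by rewrite !inE permKV yZ => /andP[].
        apply/eqP/ffunP => y; have := H y; rewrite !ffunE !inE.
        by case: ifP => _ => [/andP[/eqP]|/eqP].
      case=> /subsetP H /eqP e y; move/ffunP: e => /(_ y); rewrite !ffunE !inE.
      case: ifP => [gZ <-|_ ->//]; rewrite eqxx.
      by have := H _ gZ; rewrite inE.
    rewrite (eq_bigl _ _ eP); case: ifP => _ /=; first by [].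
    by rewrite big_pred0_eq.
  rewrite (exchange_big_dep xpredT) //= [RHS](exchange_big_dep xpredT) //=.
  apply: eq_bigr => g _.
  rewrite [RHS](reindex_onto (fun X : {set 'I_n} => g @^-1: X) (fun X => g @: X)) /=.
    apply: eq_bigl => Z; case: (P _ _) => //=.
    apply/esym/eqP/setP => y; rewrite -{1}(permKV g y) mem_imset ?inE ?permKV //.
    exact: perm_inj.
  by move=> X _; apply/setP => y; rewrite inE mem_imset //; apply: perm_inj.
apply: big1 => X _.
have [X0|[x xX]] := set_0Vmem X.
  by rewrite big_pred0 // => g; rewrite /P X0 cards0 eq_sym (gtn_eqF b_gt0).
have [cx|ncx] := eqVneq (c x) j'; last first.
  apply: big_pred0 => g; apply/negP => /andP[_ /forallP/(_ x)].
  by rewrite xX (negPf ncx).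
have [|x' rx' cx'] := diag_left D (x := x) (j := j); first by rewrite cx.
have nxx : x != x' by apply/eqP => e; move: cx ltjj; rewrite e cx' => ->; rewrite ltnn.
apply: (eq_opp0 two).
rewrite [LHS](reindex_inj (mulgI (tperm x x'))) /= -sumrN.
have x'X g : P X g -> x' \notin X.
  move=> /andP[_ /forallP/(_ x')]; case: ifP => // _ /andP[/eqP e _].
  by move: ltjj; rewrite -e cx' ltnn.
have imp g : P X g -> P X (tperm x x' * g)%g.
  move=> Pg; have nX := x'X _ Pg; move: Pg => /andP[cX /forallP H].
  rewrite /P cX; apply/forallP => y; rewrite permM.
  case: tpermP => [->|->|_ _]; last exact: H.
    by have := H x'; rewrite xX (negPf nX) cx cx' eqxx => ->.
  by have := H x; rewrite xX (negPf nX) cx' => /andP[].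
apply: eq_big => [g|g _].
  apply/idP/idP => [/imp|]; last exact: imp.
  by rewrite mulgA tperm2 mul1g.
rewrite sgpM sgp_tperm // mulN1r mulNr invMg tpermV precompM.
congr (- (_ * w (precomp _ _))).
by apply/ffunP => y; rewrite !ffunE; case: tpermP => // ->.
Qed.

End Altsum.

(** * Signed sums with prescribed values at the standard tableaux *)

Lemma diagram_row_bound n (r c : filling n) x : diagram r c -> (r x < n)%N.
Proof.
move=> D; pose T := 'I_(r x).+1.
have ex (i : T) : exists y, c y = c x /\ r y = i.
  have := ltn_ord i; rewrite ltnS leq_eqVlt => /orP[/eqP ->|/(diag_up D)[y]].
    by exists x.
  by exists y.
have [f Hf] := fin_all_exists ex.
have finj : injective f.
  by move=> i i' e; apply/val_inj; rewrite /= -(Hf i).2 -(Hf i').2 e.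
by have := leq_card f finj; rewrite !card_ord.
Qed.

Lemma expansion_bound B m (F : 'I_m -> nat) :
  (forall i, F i < B)%N -> (\sum_(i < m) F i * B ^ i < B ^ m)%N.
Proof.
elim: m F => [|m IH] F H; first by rewrite big_ord0 expn0.
rewrite big_ord_recr /=.
have := IH (fun i => F (widen_ord (leqnSn m) i)) (fun i => H _).
rewrite /= => lt; rewrite expnS; apply: (@leq_trans ((F ord_max).+1 * B ^ m)).
  by rewrite mulSn ltn_add2r.
by rewrite leq_mul2r H orbT.
Qed.

(** Read in base n with the largest number as leading digit, this compares two row tabloids at the
    largest number whose rows differ. Rows of a diagram are below n, so they are legitimate
    digits. *)
Definition lexkey n (t : filling n) : nat := (\sum_(y < n) t y * n ^ y)%N.

Lemma lexkey_lt n (t t' : filling n) y0 :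
    (forall y, t' y < n)%N -> (t' y0 < t y0)%N ->
  (forall y : 'I_n, y0 < y -> t' y = t y)%N -> (lexkey t' < lexkey t)%N.
Proof.
move=> bd lt0 eqt; rewrite /lexkey (bigID (fun y : 'I_n => y0 < y)%N) /=.
rewrite [X in (_ < X)%N](bigID (fun y : 'I_n => y0 < y)%N) /=.
rewrite (eq_bigr (fun y : 'I_n => t y * n ^ y)%N); last by move=> y /eqt ->.
rewrite ltn_add2l (bigD1 y0) ?ltnn // [X in (_ < X)%N](bigD1 y0) ?ltnn //=.
have -> : (\sum_(i < n | ~~ (y0 < i) && (i != y0)) t' i * n ^ i =
           \sum_(i < y0) t' (widen_ord (ltnW (ltn_ord y0)) i) * n ^ i)%N.
  have /= <- := @big_ord_narrow _ 0%N addn _ _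
    (fun i : 'I_n => t' i * n ^ i)%N (ltnW (ltn_ord y0)).
  by apply: eq_bigl => i; rewrite -leqNgt ltn_neqAle andbC.
have := expansion_bound (fun i => bd (widen_ord (ltnW (ltn_ord y0)) i)).
move=> lt; apply: leq_trans (leq_addr _ _).
apply: (@leq_trans ((t' y0).+1 * n ^ y0)); first by rewrite mulSn addnC ltn_add2r.
by rewrite leq_mul2r lt0 orbT.
Qed.

Definition standard n (r c : filling n) (g : 'S_n) : bool :=
  [forall x, forall y, ((r x == r y) && (c x < c y) ==> (g x < g y)) &&
                       ((c x == c y) && (r x < r y) ==> (g x < g y))]%N.

Section Standard.
Variables (n : nat) (r c : filling n).
Hypothesis D : diagram r c.

Lemma standardP (g : 'S_n) : reflect
  ((forall x y, r x = r y -> c x < c y -> g x < g y) /\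
   (forall x y, c x = c y -> r x < r y -> g x < g y))%N (standard r c g).
Proof.
apply: (iffP forallP) => [H|[H1 H2] x].
  split=> x y e l; have /forallP/(_ y)/andP[] := H x.
    by rewrite e eqxx l.
  by rewrite e eqxx l.
apply/forallP => y; apply/andP; split; apply/implyP => /andP[/eqP e l]; auto.
Qed.

(** Let z be the least number placed differently; its two boxes share a row. In the tableau with z
    further right, the other box holds a smaller number, which by minimality stands there in both
    tableaux, although one of them has z there. *)
Lemma standard_inj g g' : standard r c g -> standard r c g' ->
  precomp r g^-1%g = precomp r g'^-1%g -> g = g'.
Proof.
move=> sg sg' /ffunP e; apply/eqP/negPn/negP => neq.
have [y Py] : exists y, g^-1%g y != g'^-1%g y.
  apply/existsP; apply: contraNT neq; rewrite negb_exists => /forallP H.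
  rewrite -(inj_eq invg_inj); apply/eqP/permP => y.
  by apply/eqP; rewrite -[_ == _]negbK.
have [z Pz zmin] := @arg_minnP _ y (fun y => g^-1%g y != g'^-1%g y)
  (fun z : 'I_n => z : nat) Py.
have rz : r (g^-1%g z) = r (g'^-1%g z) by have := e z; rewrite !ffunE.
have key (h h' : 'S_n) : standard r c h' -> 
    (forall y, h^-1%g y != h'^-1%g y -> z <= y)%N ->
    r (h^-1%g z) = r (h'^-1%g z) -> (c (h^-1%g z) < c (h'^-1%g z))%N -> False.
  move=> /standardP[s' _] mn rr cc; have := s' _ _ rr cc; rewrite permKV => lt.
  have : ~~ (h^-1%g (h' (h^-1%g z)) != h'^-1%g (h' (h^-1%g z))).
    by apply/negP => /mn; rewrite leqNgt lt.
  rewrite negbK permK => /eqP/perm_inj ez; by move: lt; rewrite ez ltnn.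
case: (ltngtP (c (g^-1%g z)) (c (g'^-1%g z))) => cz.
- exact: (key g g').
- by apply: (key g' g) => // y'; rewrite eq_sym; apply: zmin.
- by move/eqP: Pz; apply; apply: (diag_inj D).
Qed.

(** The largest number whose row is changed by the column permutation moves up. Had it moved down,
    it would reach a box holding a larger number in [g]; that number keeps its row, hence its box,
    which would then be occupied twice. *)
Lemma lexkey_standard g s : standard r c g -> precomp c s = c -> s != 1%g ->
  (lexkey (precomp r (s * g)^-1%g) < lexkey (precomp r g^-1%g))%N.
Proof.
move=> /standardP[_ sg] /ffunP cs ns.
have cs' x : c (s x) = c x by have := cs x; rewrite ffunE.
have csV x : c (s^-1%g x) = c x by rewrite -{2}(permKV s x) cs'.
have [y Py] : exists y, r ((s * g)^-1%g y) != r (g^-1%g y).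
  apply/existsP; apply: contraNT ns; rewrite negb_exists => /forallP H.
  rewrite -invg_eq1; apply/eqP/permP => x; rewrite perm1.
  have := H (g x); rewrite negbK invMg permM permK => /eqP e.
  exact: (diag_inj D).
have [z Pz zmax] := @arg_maxnP _ y (fun y => r ((s * g)^-1%g y) != r (g^-1%g y))
  (fun z : 'I_n => z : nat) Py.
apply: (@lexkey_lt _ _ _ z) => [x||x zx].
- by rewrite ffunE; apply: diagram_row_bound D.
- rewrite !ffunE; rewrite ltn_neqAle Pz /= leqNgt; apply/negP => lt.
  move: lt Pz; rewrite invMg permM; set x := g^-1%g z; set x' := s^-1%g x => lt Pz.
  have : (g x < g x')%N by apply: sg lt; rewrite /x' csV.
  rewrite {1}/x permKV => zx; move: Pz => /eqP; apply.
  have : ~~ (r ((s * g)^-1%g (g x')) != r (g^-1%g (g x'))).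
    by apply/negP => /zmax; rewrite /= leqNgt zx.
  rewrite negbK invMg permM permK => /eqP e.
  have ex : s^-1%g x' = x' by apply: (diag_inj D) => //; rewrite csV.
  by congr (r _); apply: (@perm_inj _ s^-1%g); rewrite ex.
- rewrite !ffunE; apply/eqP/negPn/negP => /zmax; by rewrite /= leqNgt zx.
Qed.

(** A triangular system: in the equation at a standard [g], the unknown at the row tabloid of [g]
    has coefficient 1 or -1 and the others have smaller key by [lexkey_standard]. By [standard_inj]
    no two equations compete for the same leading unknown, so [w] is fixed key by key. *)
Lemma altsum_standard_solvable (K : fieldType) (F : filling n -> K) :
  exists w, forall g, standard r c g ->
    altsum c r w (precomp c g^-1%g) = F (precomp c g^-1%g).
Proof.
pose rest w (g : 'S_n) : K :=
  \sum_(g' | (precomp (precomp c g^-1%g) g' == c) && (g' != g))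
     sgp K g' * w (precomp r g'^-1%g).
have split_alt w g : altsum c r w (precomp c g^-1%g) =
    sgp K g * w (precomp r g^-1%g) + rest w g.
  by rewrite /altsum (bigD1 g) // precompKV.
suff [w Hw] : exists w, forall g, standard r c g ->
    (lexkey (precomp r g^-1%g) < \max_g (lexkey (precomp r g^-1%g)).+1)%N ->
    altsum c r w (precomp c g^-1%g) = F (precomp c g^-1%g).
  by exists w => g sg; apply: Hw => //; rewrite (bigmax_sup g).
elim: (\max_g _)%N => [|N [w IH]]; first by exists (fun=> 0).
pose w' t := if [pick g | [&& standard r c g, precomp r g^-1%g == t & lexkey t == N]]
  is Some g then sgp K g * (F (precomp c g^-1%g) - rest w g) else w t.
have w'lt t : (lexkey t < N)%N -> w' t = w t.
  rewrite /w'; case: pickP => // g /and3P[_ _ /eqP ->]; by rewrite ltnn.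
have restE g : standard r c g -> (lexkey (precomp r g^-1%g) <= N)%N ->
    rest w' g = rest w g.
  move=> sg lt; apply: eq_bigr => g' /andP[/eqP eg neg]; congr (_ * _).
  apply: w'lt; apply: leq_trans lt.
  have := @lexkey_standard g (g' * g^-1)%g sg; rewrite mulgKV; apply.
    by rewrite precompM.
  by rewrite -eq_mulgV1.
exists w' => g sg; rewrite ltnS => lt; rewrite split_alt restE //.
move: (lt); rewrite leq_eqVlt => /orP[eN|ltN]; last by rewrite w'lt // -split_alt IH.
rewrite /w'; case: pickP => [g' /and3P[sg' /eqP e _]|/(_ g)]; last first.
  by rewrite sg eN eqxx.
by rewrite (standard_inj sg' sg e) mulrA sgp_sqr mul1r subrK.
Qed.

End Standard.

(* Inclusion-exclusion turns the conditions [psi_at] into the Garnir          *)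
(* relations, in which the entries of [E0] stay in place.                     *)
Lemma psi_garnir (K : fieldType) n (F : filling n -> K) j j' (U : filling n) b
    (C E0 : {set 'I_n}) :
    psi_at F j j' -> j != j' -> (#|C| + #|E0| < b)%N ->
  \sum_(Z : {set 'I_n} | [&& Z \subset [set x | U x == j], C \subset Z,
                            [disjoint Z & E0] & #|Z| == b]) F (upd U Z j') = 0.
Proof.
move=> psiF njj; move: {2}#|E0| (erefl #|E0|) => k.
elim: k E0 C => [|k IH] E0 C cE ltb.
  have E00 : E0 = set0 by apply/eqP; rewrite -cards_eq0 cE.
  have [/subsetP CE|nCE] := boolP (C \subset [set x | U x == j]); last first.
    rewrite big_pred0 // => Z; apply: contraNF nCE => /and4P[ZE CZ _ _].
    exact: subset_trans CZ ZE.
  have ltC : (#|C| < b)%N by move: ltb; rewrite cE addn0.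
  (* With the entries of [C] already turned into [j'], a positive number b - #|C| of entries remains
     to be turned. *)
  rewrite -[RHS](psiF (upd U C j') (b - #|C|)%N) ?subn_gt0 //.
  rewrite (reindex_onto (fun Z => C :|: Z) (fun Z => Z :\: C)) /=; last first.
    move=> Z /and4P[_ CZ _ _]; apply/setP => x; rewrite !inE.
    by case xC: (x \in C); rewrite //= (subsetP CZ _ xC).
  apply: eq_big => Z; last first.
    move=> _; congr F; apply/ffunP => x; rewrite !ffunE !inE.
    by case: (x \in C); case: (x \in Z).
  rewrite E00 subsetUl disjoints_subset setC0 subsetT /=.
  have -> : ((C :|: Z) :\: C == Z) = [disjoint C & Z].
    by rewrite setDUl setDv set0U disjoint_sym; apply/eqP/setDidPl.
  have [dCZ|ndCZ] := boolP [disjoint C & Z]; last first.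
    rewrite andbF; apply/esym/negP => /andP[/subsetP H _]; case/negP: ndCZ.
    apply/pred0P => x /=; apply/negP => /andP[xC xZ].
    by have := H _ xZ; rewrite !inE ffunE xC eq_sym (negPf njj).
  rewrite andbT cardsU (disjoint_setI0 dCZ) cards0 subn0; congr andb.
    apply/subsetP/subsetP => H x xZ.
      have := H x; rewrite !inE xZ orbT ffunE => /(_ isT).
      by rewrite (disjointFl dCZ xZ).
    move: xZ; rewrite inE => /orP[/CE//|xZ].
    by have := H x xZ; rewrite !inE ffunE (disjointFl dCZ xZ).
  by rewrite -[RHS](eqn_add2l #|C|) subnKC // ltnW.
(* The sets avoiding [d] are all sets minus those containing [d]. Moving [d] from [E0] to [C] keeps
   #|C| + #|E0| below b. *)
have [d dE] : exists d, d \in E0.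
  by apply/card_gt0P; rewrite cE.
move: ltb; rewrite cE addnS => ltb.
have cD : #|E0 :\ d| = k by move: cE; rewrite (cardsD1 d) dE => -[].
have := IH (E0 :\ d) C cD; rewrite cD => /(_ _)/eqP.
rewrite (bigID (fun Z : {set 'I_n} => d \in Z)) /=.
rewrite [X in X + _](_ : _ = 0) ?add0r.
  move=> H; apply/eqP; rewrite -[X in _ == X](eqP (H _)); last exact: ltnW.
  apply/eqP; apply: eq_bigl => Z; rewrite -!andbA; do 2!congr andb.
  rewrite -{1}(setD1K dE) -setI_eq0 setIUr setU_eq0 !setI_eq0.
  by rewrite [[disjoint Z & [set d]]]disjoint_sym disjoints1 -andbA andbC -andbA.
rewrite -[RHS](IH (E0 :\ d) (d |: C) cD); last first.
  apply: leq_ltn_trans ltb; rewrite cD cardsU1 -addSn leq_add2r.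
  by case: (d \in C).
apply: eq_bigl => Z; rewrite subUset sub1set.
by rewrite -!andbA; case: (d \in Z); rewrite /= ?andbF ?andbT.
Qed.

Lemma ltn_sum_separated n (A B : {set 'I_n}) (th : nat) : #|A| = #|B| -> A != B ->
    (forall y, y \in A -> y \notin B -> th <= y)%N ->
    (forall y : 'I_n, y \in B -> y < th)%N ->
  (\sum_(y in B) y < \sum_(y in A) y)%N.
Proof.
move=> cAB nAB hA hB; rewrite (big_setID A) [X in (_ < X)%N](big_setID B) /=.
rewrite setIC ltn_add2l.
have cD : #|A :\: B| = #|B :\: A| by rewrite !cardsD cAB setIC.
have gt0 : (0 < #|A :\: B|)%N.
  rewrite card_gt0 setD_eq0; apply: contra nAB => sAB.
  by rewrite eqEcard sAB cAB leqnn.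
have leA : (#|A :\: B| * th <= \sum_(y in A :\: B) y)%N.
  by rewrite -sum_nat_const; apply: leq_sum => y; rewrite inE => /andP[? /hA]; apply.
have leB : (\sum_(y in B :\: A) y.+1 <= #|B :\: A| * th)%N.
  by rewrite -sum_nat_const; apply: leq_sum => y; rewrite inE => /andP[_ /hB].
move: leB; under eq_bigr do rewrite -addn1.
rewrite big_split /= sum_nat_const muln1 => leB.
by apply: leq_trans leA; rewrite cD; apply: leq_trans leB; rewrite -addn1 leq_add2l -cD.
Qed.

(** The quantity that increases during straightening: it grows when larger numbers move to columns
    further right. *)
Definition moment n (h : filling n) : nat := (\sum_(y < n) y * h y)%N.

Lemma moment_upd n (U : filling n) (Z : {set 'I_n}) j :
    (forall y, y \in Z -> U y = j) ->
  moment (upd U Z j.+1) = (moment U + \sum_(y in Z) y)%N.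
Proof.
move=> H; rewrite /moment [(\sum_(y in Z) _)%N]big_mkcond -big_split /=; apply: eq_bigr => y _.
by rewrite ffunE; case: ifP => [/H ->|_]; rewrite ?mulnS 1?addnC ?add0n.
Qed.

(** * Straightening of column tabloids *)

Section Straightening.
Variables (K : fieldType) (n : nat) (r c : filling n).
Hypotheses (two : (2%:R : K) != 0) (D : diagram r c).

(** Among the tableaux with column tabloid [h], one that maximises the sum of row times number has
    increasing columns, as exchanging a descent would raise the sum. *)
Lemma column_sorting h g0 : precomp h g0 = c ->
  exists2 g, precomp h g = c & forall x y, c x = c y -> (r x < r y)%N -> (g x < g y)%N.
Proof.
move=> /eqP H0.
have [g /eqP Hg gmax] := @arg_maxnP _ g0 (fun g => precomp h g == c)
   (fun g : 'S_n => \sum_x r x * g x)%N H0.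
exists g => // x y cxy rxy; rewrite ltnNge; apply/negP => gyx.
have nxy : x != y by apply: contraTneq rxy => ->; rewrite ltnn.
have gneq : (g y != g x :> nat)%N by rewrite (inj_eq val_inj) (inj_eq perm_inj) eq_sym.
have /gmax /= : precomp h (tperm x y * g) == c.
  rewrite precompM Hg; apply/eqP/ffunP => z; rewrite ffunE.
  by case: tpermP => [->|->|].
rewrite (bigD1 x) // [X in (_ <= X)%N](bigD1 x) //=.
rewrite (bigD1 y) 1?eq_sym // [X in (_ <= _ + X)%N](bigD1 y) 1?eq_sym //=.
rewrite !permM tpermL tpermR.
rewrite (eq_bigr (fun i => r i * g i)%N); last first.
  by move=> i /andP[ix iy]; rewrite permM tpermD // eq_sym.
rewrite !addnA leq_add2r; move: gneq gyx rxy.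
move: (r x) (r y) (g x : nat) (g y : nat) => a b u v; nia.
Qed.

Lemma row_violation (g : 'S_n) :
    (forall x y, c x = c y -> (r x < r y)%N -> (g x < g y)%N) ->
    ~~ standard r c g ->
  exists x y, [/\ r x = r y, c y = (c x).+1 & (g y < g x)%N].
Proof.
move=> cols nstd.
have [/existsP[x /existsP[y /and3P[/eqP ? /eqP ? ?]]]|noviol] :=
  boolP [exists x, exists y, [&& r x == r y, c y == (c x).+1 & (g y < g x)%N]].
  by exists x, y.
case/negP: nstd; apply/standardP; split=> // x y rxy cxy.
have adj u v : r u = r v -> c v = (c u).+1 -> (g u < g v)%N.
  move=> ruv cuv; rewrite ltnNge leq_eqVlt; apply/negP => /orP[/eqP/val_inj/perm_inj e|lt].
    by move: cuv; rewrite e; lia.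
  case/negP: noviol; apply/existsP; exists u; apply/existsP; exists v.
  by rewrite ruv cuv !eqxx.
move: {2}(c y - c x)%N (leqnn (c y - c x)) => k; elim: k y rxy cxy => [|k IH] y rxy cxy.
  by lia.
move=> le; have [z rz cz] := @diag_left _ _ _ D y (c y).-1 ltac:(lia).
have lt : (g z < g y)%N by apply: adj; lia.
have [e|ne] := eqVneq z x; first by rewrite -e.
apply: ltn_trans lt; apply: IH; rewrite ?rz //; last by lia.
have : c z <> c x by move=> e; case/eqP: ne; apply: (diag_inj D); rewrite ?rz.
lia.
Qed.

(** Descending induction on the moment, which is bounded on the support of [F]. At a row descent of
    a column-sorted tableau, the Garnir relation expresses [F h] through values at column tabloids
    of larger moment. *)
Lemma straightening (F : filling n -> K) :
    (forall j, psi_at F j j.+1) ->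
    (forall h, F h != 0 -> exists g, precomp h g = c) ->
    (forall g, standard r c g -> F (precomp c g^-1%g) = 0) ->
  forall h, F h = 0.
Proof.
move=> psiF supp stdF.
pose M := (n * \sum_x c x)%N.
have bound h g : precomp h g = c -> (moment h <= M)%N.
  move=> e; rewrite /M -e big_distrr /= /moment (reindex_inj (@perm_inj _ g)) /=.
  by apply: leq_sum => y _; rewrite ffunE leq_mul2r ltnW ?orbT.
move=> h; move: {2}(M - moment h)%N (leqnn (M - moment h)) => k.
elim/ltn_ind: k h => k IH h lek; apply/eqP/negPn/negP => /[dup] Fh /supp[g0].
move=> /column_sorting[g eg cols].
have gV y : h y = c (g^-1%g y) by rewrite -eg ffunE permKV.
have [std|nstd] := boolP (standard r c g).
  by case/negP: Fh; rewrite -(precompK h g) eg stdF.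
have [x [y [rxy cxy lt]]] := row_violation cols nstd.
set j := c x in cxy.
(* The classical Garnir boxes: [B] is the column of y down to y, and [E0] the column of x strictly
   above x. The numbers in [B] are moved to column j, those in [E0] must stay there; since [B] is
   larger than [E0], [psi_garnir] applies. *)
pose B := [set z | (c z == j.+1) && (r z <= r x)%N].
pose E0 := [set z | (c z == j) && (r z < r x)%N].
pose U := upd h (g @: B) j.
have memg z (S : {set 'I_n}) : (z \in g @: S) = (g^-1%g z \in S).
  by rewrite -{1}(permKV g z) mem_imset //; apply: perm_inj.
have yB : y \in B by rewrite inE cxy rxy leqnn eqxx.
have cE : (#|E0| < #|B|)%N.
  pose phi z := odflt z [pick u | (c u == j) && (r u == r z)].
  rewrite (cardsD1 y B) yB ltnS; apply: leq_trans (leq_imset_card phi _).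
  apply/subset_leq_card/subsetP => z; rewrite inE => /andP[/eqP cz rz].
  have [u cu ru] := @diag_up _ _ _ D y (r z) ltac:(by rewrite -rxy).
  apply/imsetP; exists u.
    rewrite !inE cu cxy ru eqxx ltnW // !andbT; apply: contraTneq rz => e.
    by rewrite -ru e rxy ltnn.
  rewrite /phi; case: pickP => [u' /andP[/eqP cu' /eqP ru']|/(_ z)] /=.
    by apply: (diag_inj D); rewrite ?cu' ?ru' ?ru.
  by rewrite cz ru !eqxx.
have gb : #|g @: B| = #|B| by rewrite card_imset //; apply: perm_inj.
have Bj z : z \in g @: B -> h z = j.+1.
  by rewrite memg inE gV => /andP[/eqP].
have updB : upd U (g @: B) j.+1 = h.
  by apply/ffunP => z; rewrite ffunE; case: ifP => [/Bj ->|zB] //; rewrite ffunE zB.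
have := @psi_garnir _ _ F j j.+1 U #|B| set0 (g @: E0) (psiF j).
rewrite neq_ltn ltnSn cards0 card_imset; last exact: perm_inj.
move=> /(_ isT cE).
rewrite (bigD1 (g @: B)) /=; last first.
  rewrite gb eqxx sub0set andbT; apply/andP; split.
    by apply/subsetP => z zB; rewrite inE ffunE zB.
  rewrite -setI_eq0 -imsetI; last by move=> ? ? _ _; apply: perm_inj.
  rewrite imset_eq0; apply/eqP/setP => z; rewrite !inE.
  by case: eqP => // ->; rewrite gtn_eqF ?andbF.
rewrite updB big1 ?addr0; first by move=> e; rewrite e eqxx in Fh.
move=> Z /andP[/and4P[/subsetP ZE _ dZ /eqP cZ] nZ].
apply/eqP/negPn/negP => FZ; have [g1 /bound leM] := supp _ FZ.
have Zj z : z \in Z -> U z = j by move=> /ZE; rewrite inE => /eqP.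
(* [Z] trades numbers of [g @: B], all at most [g y], for numbers of column j in row [r x] or lower
   down, all at least [g x], and [g y < g x]. *)
have ltm : (moment h < moment (upd U Z j.+1))%N.
  rewrite moment_upd // -{1}updB moment_upd; last by move=> z zB; rewrite ffunE zB.
  rewrite ltn_add2l; apply: (@ltn_sum_separated _ _ _ (g x)) => [|//|z zZ znB|z].
  - by rewrite gb.
  - have := Zj _ zZ; rewrite ffunE (negPf znB) gV => cz.
    have : z \notin g @: E0 by rewrite (disjointFr dZ zZ).
    rewrite memg inE cz eqxx /= -leqNgt leq_eqVlt => /orP[/eqP rz|rz].
      by rewrite (diag_inj D rz) ?permKV // cz.
    by rewrite -(permKV g z) ltnW // cols.
  - rewrite memg inE => /andP[/eqP cz rz]; apply: leq_ltn_trans lt.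
    rewrite -(permKV g z); move: rz; rewrite rxy leq_eqVlt => /orP[/eqP rz|rz].
      by rewrite (diag_inj D rz) // cz cxy.
    by rewrite ltnW // cols // cz cxy.
move/eqP: FZ; apply; apply: (IH (M - moment (upd U Z j.+1))%N) => //.
by lia.
Qed.

(* Both sides satisfy the exchange conditions and agree at the standard       *)
(* tableaux, which determine them.                                            *)
Theorem psi_altsum (F : filling n -> K) :
    (forall j, psi_at F j j.+1) ->
    (forall h, F h != 0 -> exists g, precomp h g = c) ->
  exists w, forall h, F h = altsum c r w h.
Proof.
move=> psiF supp; have [w Hw] := altsum_standard_solvable D F.
exists w => h; apply/eqP; rewrite -subr_eq0; apply/eqP; move: h.
apply: straightening => [j U b b0|h|g sg].
- by rewrite sumrB psiF // (altsum_psi two D) ?subr0.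
- have [F0|/supp//] := eqVneq (F h) 0; rewrite F0 sub0r oppr_eq0 => H.
  have [g /eqP|no] := pickP (fun g => precomp h g == c); first by exists g.
  by rewrite /altsum big_pred0 ?eqxx in H.
- by rewrite Hw ?subrr.
Qed.

End Straightening.

(** * Presentation of Specht modules *)

Definition tcnt n (S : {set 'I_n}) (f : filling n) (a : nat) : nat :=
  (\sum_(x in S) (f x == a))%N.

Lemma tcnt_card n (S : {set 'I_n}) f a : tcnt S f a = #|[set x in S | f x == a]|.
Proof.
rewrite /tcnt -sum1dep_card [RHS]big_mkcondr; apply: eq_bigr => x _.
by case: eqP.
Qed.

Lemma tcnt_perm n (S : {set 'I_n}) f g a : perm_on S g ->
  tcnt S (precomp f g) a = tcnt S f a.
Proof.
move=> Sg; rewrite /tcnt [RHS](reindex_inj (@perm_inj _ g)) /=.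
by apply: eq_big => [x|x _]; rewrite ?(perm_closed _ Sg) ?ffunE.
Qed.

Lemma perm_onT n (g : 'S_n) : perm_on [set: 'I_n] g.
Proof. by apply/subsetP => x _; rewrite inE. Qed.

Lemma tperm_on_set n (S : {set 'I_n}) x y : x \in S -> y \in S -> perm_on S (tperm x y).
Proof.
move=> xS yS; apply/subsetP => z; rewrite inE.
by case: tpermP => [->|->|]; rewrite ?eqxx.
Qed.

Lemma tcnt_tperm n (S : {set 'I_n}) (f : filling n) x y a : x \notin S -> y \in S ->
  (tcnt S (precomp f (tperm x y)) a + (f y == a) = tcnt S f a + (f x == a))%N.
Proof.
move=> xS yS; rewrite /tcnt (bigD1 y) // [in RHS](bigD1 y) //= ffunE tpermR.
have -> : (\sum_(i in S | i != y) (precomp f (tperm x y) i == a) =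
           \sum_(i in S | i != y) (f i == a))%N.
  apply: eq_bigr => z /andP[zS zy]; rewrite ffunE tpermD // 1?eq_sym //.
  by apply: contraNneq xS => <-.
by rewrite addnAC -addnA addnC.
Qed.

Lemma tcnt_upd n (S : {set 'I_n}) (U : filling n) (Z : {set 'I_n}) j j' a :
    (forall x, x \in Z -> U x = j) ->
  (tcnt S (upd U Z j') a + #|S :&: Z| * (j == a) =
   tcnt S U a + #|S :&: Z| * (j' == a))%N.
Proof.
move=> H; rewrite /tcnt (big_setID Z) [in RHS](big_setID Z) /=.
rewrite (eq_bigr (fun=> (j' == a) : nat)); last first.
  by move=> x; rewrite inE ffunE => /andP[_ ->].
rewrite [in RHS](eq_bigr (fun=> (j == a) : nat)); last first.
  by move=> x; rewrite inE => /andP[_ /H ->].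
rewrite [(\sum_(x in S :\: Z) (upd _ _ _ _ == a))%N](eq_bigr (fun x => (U x == a) : nat)).
  by rewrite !sum_nat_const addnAC [RHS]addnC addnA.
by move=> x; rewrite inE ffunE => /andP[/negPf ->].
Qed.

Lemma tcntID n (S : {set 'I_n}) (f : filling n) a :
  tcnt setT f a = (tcnt S f a + tcnt (~: S) f a)%N.
Proof.
by rewrite /tcnt (big_setID S) /= setTI setTD.
Qed.

(** If f and f' disagree at x, counting the value [f' x] yields a box y of [S] that holds it in f
    but not in f'. Exchanging x and y repairs x, and y was wrong already, so the disagreements
    decrease. *)
Lemma tcnt_sym n (T : Type) (S : {set 'I_n}) (v : filling n -> T) :
    (forall f x y, x \in S -> y \in S -> v (precomp f (tperm x y)) = v f) ->
  forall f f' : filling n, (forall x, x \notin S -> f x = f' x) ->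
    (forall a, tcnt S f a = tcnt S f' a) -> v f = v f'.
Proof.
move=> sym f f'; move: {2}#|[set x | f x != f' x]| (leqnn #|[set x | f x != f' x]|) => k.
elim: k f => [|k IH] f le off cnt.
  congr v; apply/ffunP => x; apply/eqP; move: le; rewrite leqn0 cards_eq0 => /eqP/setP.
  by move=> /(_ x); rewrite !inE => /negbFE.
have [e|[x]] := set_0Vmem [set x | f x != f' x].
  by apply: IH => //; rewrite e cards0.
rewrite inE => nx.
have xS : x \in S by apply: contraNT nx => /off ->.
have [y /andP[yS /andP[/eqP fy f'y]]] :
    exists y, (y \in S) && ((f y == f' x) && (f' y != f' x)).
  apply/existsP; apply: contraT; rewrite negb_exists => /forallP H.
  have := cnt (f' x); rewrite !tcnt_card => /eqP.
  rewrite ltn_eqF //; apply: proper_card; apply/properP; split.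
    apply/subsetP => y; rewrite !inE => /andP[yS fy].
    by have := H y; rewrite yS fy /= negbK.
  by exists x; rewrite !inE xS ?eqxx //= (negPf nx).
have nxy : x != y by apply: contraNneq nx => e; rewrite -fy e.
rewrite -(sym f x y) //; apply: IH => [|z zS|a].
- rewrite -ltnS; apply: leq_trans le; apply: proper_card; apply/properP; split.
    apply/subsetP => z; rewrite !inE ffunE.
    case: tpermP => [->|->|//]; first by rewrite fy eqxx.
    by move=> _; rewrite fy eq_sym.
  by exists x; rewrite !inE // ffunE tpermL fy eqxx.
- rewrite ffunE tpermD ?off //; apply: contraNneq zS => <-; by [].
- by rewrite tcnt_perm ?tperm_on_set.
Qed.

(** Being a rearrangement of f' within [S] is itself invariant under transpositions of [S], so
    [tcnt_sym] applies to this Boolean function. *)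
Lemma tcnt_perm_ex n (S : {set 'I_n}) (f f' : filling n) :
    (forall x, x \notin S -> f x = f' x) -> (forall a, tcnt S f a = tcnt S f' a) ->
  exists2 g, perm_on S g & precomp f g = f'.
Proof.
move=> off cnt.
pose v h := [exists g : 'S_n, perm_on S g && (precomp h g == f')].
have imp h x y : x \in S -> y \in S -> v h -> v (precomp h (tperm x y)).
  move=> xS yS /existsP[g /andP[Sg /eqP eg]]; apply/existsP; exists (g * tperm x y)%g.
  by rewrite perm_onM ?tperm_on_set //= -precompM -mulgA tperm2 mulg1 eg.
have : v f' by apply/existsP; exists 1%g; rewrite perm_on1 precomp1 eqxx.
rewrite -(@tcnt_sym _ _ S v _ f f' off cnt).
  by case/existsP=> g /andP[Sg /eqP eg]; exists g.
move=> h x y xS yS; apply/idP/idP => [/(imp _ _ _ xS yS)|]; last exact: imp.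
by rewrite -precompM tperm2 precomp1.
Qed.

(** * Linear maps on the span of the translates of a polytabloid *)

Section Representable.
Variables (K : fieldType) (n : nat) (r c : filling n).
Hypotheses (two : (2%:R : K) != 0) (D : diagram r c).

Definition alternating (v : filling n -> K) :=
  forall (s : 'S_n) f, precomp c s = c -> v (precomp f s) = sgp K s * v f.

(* [v] is the coefficient function of the image of the polytabloid of (r, c)  *)
(* under a linear map compatible with the translates of the polytabloid.      *)
Definition representable (v : filling n -> K) := forall f, exists w, forall g : 'S_n,
  v (precomp f g) = \sum_(s | precomp c s == c) sgp K s * w (precomp r (s * g)^-1%g).

(* Column-tabloid form of [g |-> sgn(g) v(f o g)]. *)
Definition colform (v : filling n -> K) (f h : filling n) : K :=
  if [pick g | precomp h g == c] is Some g then sgp K g * v (precomp f g) else 0.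

Lemma representable_alternating v : representable v -> alternating v.
Proof.
move=> rep s f cs; have [w Hw] := rep f; rewrite Hw.
have := Hw 1%g; rewrite precomp1 => ->; rewrite mulr_sumr.
rewrite (reindex_inj (mulIg s^-1%g)) /=; apply: eq_big => [t|t _].
  by rewrite precompM -{1}cs precompK.
by rewrite mulgKV mulg1 sgpM sgpV mulrA [_ * sgp K s]mulrC.
Qed.

Lemma alternating_eq0 v (f : filling n) x y :
    alternating v -> x != y -> c x = c y -> f x = f y ->
  v f = 0.
Proof.
move=> alt nxy cxy fxy; apply: (eq_opp0 two).
have e : precomp f (tperm x y) = f.
  by apply/ffunP => z; rewrite ffunE; case: tpermP => // ->.
rewrite -{1}e alt ?sgp_tperm ?mulN1r //.
by apply/ffunP => z; rewrite ffunE; case: tpermP => // ->.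
Qed.

Lemma colformE v f h g : alternating v -> precomp h g = c ->
  colform v f h = sgp K g * v (precomp f g).
Proof.
move=> alt hg; rewrite /colform; case: pickP => [g' /eqP hg'|/(_ g)]; last first.
  by rewrite hg eqxx.
have e : (g' = (g' * g^-1) * g)%g by rewrite mulgKV.
have cs : precomp c (g' * g^-1)%g = c by rewrite -{1}hg -precompM -e.
by rewrite {1 2}e precompM alt // sgpM mulrACA sgp_sqr mul1r.
Qed.

Lemma colform_supp v f h : colform v f h != 0 -> exists g, precomp h g = c.
Proof.
rewrite /colform; case: pickP => [g /eqP hg _|_]; last by rewrite eqxx.
by exists g.
Qed.

Lemma colform_precomp v f h k : alternating v ->
  colform v f h = sgp K k * colform v (precomp f k) (precomp h k).
Proof.
move=> alt; have [g /eqP hg|no] := pickP (fun g => precomp h g == c).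
  rewrite (colformE _ alt hg) (@colformE _ _ _ (g * k^-1)%g) //; last first.
    by rewrite -precompM mulgKV.
  by rewrite -precompM mulgKV sgpM sgpV mulrA [sgp K k * _]mulrCA sgp_sqr mulr1.
rewrite {1}/colform; case: pickP => [g|_]; first by rewrite no.
rewrite /colform; case: pickP => [g|_]; last by rewrite mulr0.
by rewrite -precompM no.
Qed.

(** The tableaux with the column tabloid of [g] are the products [s * g] with [s] in the column
    stabiliser. *)
Lemma polytabloid_altsum w h g : precomp h g = c ->
  \sum_(s | precomp c s == c) sgp K s * w (precomp r (s * g)^-1%g) =
  sgp K g * altsum c r w h.
Proof.
move=> hg; rewrite /altsum mulr_sumr [RHS](reindex_inj (mulIg g)) /=.
apply: eq_big => [s|s _]; first by rewrite precompM hg.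
by rewrite sgpM -mulrA [RHS]mulrCA [X in _ = _ * X]mulrA sgp_sqr mul1r.
Qed.

Lemma representable_colform v f : representable v ->
  exists w, forall h, colform v f h = altsum c r w h.
Proof.
move=> rep; have [w Hw] := rep f; exists w => h.
have alt := representable_alternating rep.
have [g /eqP hg|no] := pickP (fun g => precomp h g == c).
  by rewrite (colformE _ alt hg) Hw (polytabloid_altsum _ hg) mulrA sgp_sqr mul1r.
by rewrite /colform /altsum big_pred0 //; case: pickP => // g; rewrite no.
Qed.

Lemma representable_psi v f j j' : representable v -> (j < j')%N ->
  psi_at (colform v f) j j'.
Proof.
move=> rep ltjj U b b0; have [w Hw] := representable_colform f rep.
rewrite (eq_bigr (fun Z : {set 'I_n} => altsum c r w (upd U Z j'))) //.
exact: (altsum_psi two D).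
Qed.

(** Relations between adjacent columns suffice, by [psi_altsum] applied to the column form of
    [v]. *)
Lemma psi_representable v : alternating v ->
    (forall f j, psi_at (colform v f) j j.+1) -> representable v.
Proof.
move=> alt psi f; have [w Hw] := psi_altsum two D (psi f) (@colform_supp v f).
exists w => g; rewrite (@polytabloid_altsum _ (precomp c g^-1%g)); last by rewrite precompKV.
rewrite -Hw (@colformE _ _ _ g) // ?precompKV //.
by rewrite mulrA sgp_sqr mul1r.
Qed.

Lemma sum_set1 (E : {set 'I_n}) (F : {set 'I_n} -> K) :
  \sum_(Z : {set 'I_n} | (Z \subset E) && (#|Z| == 1%N)) F Z =
  \sum_(x in E) F [set x].
Proof.
rewrite -(big_imset F (h := set1)) /=; last by move=> x y _ _; apply: set1_inj.
apply: eq_bigl => Z; apply/andP/imsetP => [[ZE /cards1P[x Zx]]|[x xE ->]].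
  by exists x => //; move: ZE; rewrite Zx sub1set.
by rewrite sub1set cards1.
Qed.

(** The condition with a single moved box: y is put into column j and one box of that column is sent
    to the old column of y. Sending y back gives [v f]; sending x instead is an exchange of x and y,
    with sign -1. *)
Lemma colform_exchange_sum v f j y : alternating v -> c y != j ->
  \sum_(Z : {set 'I_n} | (Z \subset [set x | upd c [set y] j x == j]) && (#|Z| == 1%N))
      colform v f (upd (upd c [set y] j) Z (c y)) =
  v f - \sum_(x | c x == j) v (precomp f (tperm x y)).
Proof.
move=> alt ny; rewrite sum_set1 (bigD1 y) /=; last by rewrite !inE ffunE inE eqxx.
congr (_ + _).
  rewrite (@colformE _ _ _ 1%g) // ?odd_perm1 ?expr0 ?mul1r ?precomp1 //.
  apply/ffunP => x; rewrite !ffunE !inE; by case: eqP => [->|].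
rewrite -sumrN; apply: eq_big => [x|x].
  rewrite !inE !ffunE !inE; case: (eqVneq x y) => [->|_] /=; last by rewrite andbT.
  by rewrite (negPf ny) andbF.
rewrite !inE !ffunE !inE => /andP[+ nxy]; rewrite (negPf nxy) => /eqP cx.
rewrite (@colformE _ _ _ (tperm x y)) // ?sgp_tperm ?mulN1r //.
apply/ffunP => z; rewrite !ffunE !inE.
case: tpermP => [->|->|/eqP zx /eqP zy].
- by rewrite eqxx eq_sym (negPf nxy).
- by rewrite eqxx.
- by rewrite (negPf zx) (negPf zy).
Qed.

Lemma representable_exchange v f j y : representable v -> (j < c y)%N ->
  v f = \sum_(x | c x == j) v (precomp f (tperm x y)).
Proof.
move=> rep ltj; apply/eqP; rewrite -subr_eq0.
rewrite -colform_exchange_sum ?(gtn_eqF ltj) //; last exact: representable_alternating.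
by rewrite representable_psi.
Qed.

Lemma precomp_upd (U : filling n) Z a (k : 'S_n) :
  precomp (upd U Z a) k = upd (precomp U k) (k @^-1: Z) a.
Proof. by apply/ffunP => x; rewrite !ffunE !inE. Qed.

(** A sum with a non-zero term involves a column tabloid that is a rearrangement of [c] by some [k];
    [colform_precomp] transports the whole sum along [k] to one in which boxes of [c] itself are
    moved. *)
Lemma garnir_representable v : alternating v ->
    (forall f j (B : {set 'I_n}), B \subset [set x | c x == j.+1] -> B != set0 ->
       \sum_(Z : {set 'I_n} | (Z \subset [set x | upd c B j x == j]) && (#|Z| == #|B|))
          colform v f (upd (upd c B j) Z j.+1) = 0) ->
  representable v.
Proof.
move=> alt garnir; apply: psi_representable => // f j U b b0.
have [/existsP[Z0 /andP[/andP[ZE cZ] nz]]|none] := boolP [exists Z : {set 'I_n},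
   ((Z \subset [set x | U x == j]) && (#|Z| == b)) && (colform v f (upd U Z j.+1) != 0)];
   last first.
  apply: big1 => Z HZ; apply/eqP; apply: contraNT none => nz.
  by apply/existsP; exists Z; rewrite HZ.
have [k ek] := colform_supp nz.
pose B := k @^-1: Z0.
have eU : upd c B j = precomp U k.
  apply/ffunP => x; rewrite -ek !ffunE inE; case kx: (k x \in Z0) => //.
  by have := subsetP ZE _ kx; rewrite inE => /eqP.
have cB : #|B| = b by rewrite card_preimset ?(eqP cZ) //; apply: perm_inj.
transitivity (sgp K k * (\sum_(Z : {set 'I_n} |
    (Z \subset [set x | upd c B j x == j]) && (#|Z| == #|B|))
          colform v (precomp f k) (upd (upd c B j) Z j.+1))); last first.
  rewrite garnir ?mulr0 // -?card_gt0 ?cB //.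
  by apply/subsetP => x xB; rewrite inE -ek !ffunE; move: xB; rewrite inE => ->.
rewrite mulr_sumr.
rewrite [RHS](reindex_onto (fun Z : {set 'I_n} => k @^-1: Z) (fun Z => k @: Z)); last first.
  by move=> Z _; apply/setP => x; rewrite inE mem_imset //; apply: perm_inj.
apply: eq_big => [Z|Z _]; last by rewrite (colform_precomp _ _ k alt) precomp_upd eU.
rewrite eU cB card_preimset; last exact: perm_inj.
have -> : k @: (k @^-1: Z) == Z.
  apply/eqP/setP => y; rewrite -{1}(permKV k y) mem_imset ?inE ?permKV //.
  exact: perm_inj.
rewrite andbT; congr andb; apply/subsetP/subsetP => H x.
  by rewrite !inE ffunE => /H; rewrite inE.
by rewrite -{1}(permKV k x) => xZ; have := H (k^-1%g x);
  rewrite !inE ffunE permKV => -> //; rewrite -{1}(permKV k x).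
Qed.

End Representable.

(** * Lengthening the first row *)

Section Embedding.
Variables n m : nat.

Definition emb_fun (g : 'S_n) (x : 'I_(n + m)) : 'I_(n + m) :=
  match split x with inl a => lshift m (g a) | inr b => rshift n b end.

Lemma emb_funL g x : emb_fun g (lshift m x) = lshift m (g x).
Proof. by rewrite /emb_fun (unsplitK (inl x)). Qed.

Lemma emb_funR g y : emb_fun g (rshift n y) = rshift n y.
Proof. by rewrite /emb_fun (unsplitK (inr y)). Qed.

Lemma emb_fun_inj g : injective (emb_fun g).
Proof.
apply: (can_inj (g := emb_fun g^-1%g)) => x.
by case: (split_ordP x) => y ->; rewrite ?emb_funL ?emb_funR ?permK.
Qed.

Definition emb (g : 'S_n) : 'S_(n + m) := perm (@emb_fun_inj g).

Lemma embL g x : emb g (lshift m x) = lshift m (g x).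
Proof. by rewrite permE emb_funL. Qed.

Lemma embR g y : emb g (rshift n y) = rshift n y.
Proof. by rewrite permE emb_funR. Qed.

Lemma embM g h : emb (g * h)%g = (emb g * emb h)%g.
Proof.
by apply/permP => x; case: (split_ordP x) => y ->; rewrite permM ?embL ?embR // permM.
Qed.

Lemma emb1 : emb 1%g = 1%g.
Proof. by apply: (mulgI (emb 1)); rewrite -embM !mulg1. Qed.

Lemma embV g : emb g^-1%g = ((emb g)^-1)%g.
Proof. by apply/eqP; rewrite eq_sym eq_invg_mul -embM mulgV emb1. Qed.

Lemma emb_tperm x y : emb (tperm x y) = tperm (lshift m x) (lshift m y).
Proof.
apply/permP => z; case: (split_ordP z) => u ->.
  rewrite embL; case: tpermP => [->|->|/eqP ux /eqP uy]; rewrite ?tpermL ?tpermR //.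
  by rewrite tpermD // (inj_eq (@lshift_inj _ _)) eq_sym.
by rewrite embR tpermD // eq_lrshift.
Qed.

Lemma odd_emb g : odd_perm (emb g) = odd_perm g.
Proof.
have [ts -> _] := prod_tpermP g; elim: ts => [|t ts IH].
  by rewrite big_nil emb1 !odd_perm1.
rewrite big_cons embM !odd_permM IH emb_tperm !odd_tperm.
by rewrite (inj_eq (@lshift_inj _ _)).
Qed.

Lemma emb_inj : injective emb.
Proof.
move=> g h e; apply/permP => x; apply: (@lshift_inj n m).
by rewrite -!embL e.
Qed.

Lemma emb_surj (s : 'S_(n + m)) :
  (forall y, s (rshift n y) = rshift n y) -> exists g, s = emb g.
Proof.
move=> sR.
have ex x : exists y, s (lshift m x) = lshift m y.
  case: (split_ordP (s (lshift m x))) => y e; first by exists y.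
  have /eqP := @perm_inj _ s _ _ (etrans e (esym (sR y))).
  by rewrite eq_lrshift.
have [f Hf] := fin_all_exists ex.
have finj : injective f.
  move=> x y e; apply: (@lshift_inj n m); apply: (@perm_inj _ s).
  by rewrite !Hf e.
exists (perm finj); apply/permP => x; case: (split_ordP x) => y ->.
  by rewrite Hf embL permE.
by rewrite sR embR.
Qed.

(** Zero is both the row of the new boxes and the entry written into them, so the same padding
    serves diagrams and fillings. *)
Definition padz (f : filling n) : filling (n + m) :=
  [ffun x => match split x with inl a => f a | inr _ => 0%N end].

Lemma padzL f x : padz f (lshift m x) = f x.
Proof. by rewrite ffunE (unsplitK (inl x)). Qed.

Lemma padzR f y : padz f (rshift n y) = 0%N.
Proof. by rewrite ffunE (unsplitK (inr y)). Qed.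

Definition restr (f : filling (n + m)) : filling n := [ffun x => f (lshift m x)].

Lemma restr_padz f : restr (padz f) = f.
Proof. by apply/ffunP => x; rewrite ffunE padzL. Qed.

Lemma padz_emb f g : padz (precomp f g) = precomp (padz f) (emb g).
Proof.
apply/ffunP => x; rewrite [RHS]ffunE; case: (split_ordP x) => y ->.
  by rewrite embL !padzL ffunE.
by rewrite embR !padzR.
Qed.

Lemma tcnt_split (S : {set 'I_(n + m)}) (f : filling (n + m)) a :
  tcnt S f a = (tcnt [set x | lshift m x \in S] (restr f) a +
                \sum_(y < m | rshift n y \in S) (f (rshift n y) == a))%N.
Proof.
rewrite /tcnt big_split_ord /=; congr addn.
by apply: eq_big => x; rewrite ?inE // ffunE.
Qed.

End Embedding.

Definition symmetric_on (K : fieldType) n (S : {set 'I_n}) (v : filling n -> K) :=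
  forall f x y, x \in S -> y \in S -> v (precomp f (tperm x y)) = v f.

(** The exchange relation with a single-box column has only one term. *)
Lemma representable_symmetric_on (K : fieldType) n (r c : filling n)
    (S : {set 'I_n}) (v : filling n -> K) :
    (2%:R : K) != 0 -> diagram r c -> (forall x y, x \in S -> c x = c y -> x = y) ->
  representable r c v -> symmetric_on S v.
Proof.
move=> two D Sinj rep f x y; wlog lt : x y / (c x < c y)%N => [H xt yt|xt yt].
  case: (ltngtP (c x) (c y)) => [lt|lt|e]; first exact: H.
    by rewrite tpermC; apply: H.
  by rewrite (Sinj _ _ xt e) tperm1 precomp1.
rewrite [RHS](representable_exchange two D f rep lt) (big_pred1 x) // => z /=.
by apply/eqP/eqP => [e|-> //]; rewrite (Sinj _ _ xt (esym e)).
Qed.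

Lemma inj_count n (S : {set 'I_n}) (c : 'I_n -> nat) q :
    {in S &, injective c} -> (forall x, x \in S -> (c x < q)%N) ->
  (#|S| <= q)%N /\ ((q <= #|S|)%N -> forall j, (j < q)%N -> exists2 x, x \in S & c x = j).
Proof.
move=> inj lt.
have un : uniq (map c (enum S)).
  by rewrite map_inj_in_uniq ?enum_uniq // => x y; rewrite !mem_enum; apply: inj.
have sub : {subset map c (enum S) <= iota 0 q}.
  by move=> j /mapP[x]; rewrite mem_enum => /lt ltq ->; rewrite mem_iota.
have sz : size (map c (enum S)) = #|S| by rewrite size_map -cardE.
split; first by have := uniq_leq_size un sub; rewrite sz size_iota.
move=> le j ltj; have [] := uniq_min_size un sub; first by rewrite size_iota sz.
move=> _ /(_ j); rewrite mem_iota ltj => /mapP[x]; rewrite mem_enum => xS ->.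
by exists x.
Qed.

(** * Fillings with a repeated entry in a column *)

Section Doubled.
Variables (K : fieldType) (n : nat) (c : filling n) (v : filling n -> K).
Hypotheses (two : (2%:R : K) != 0) (alt : alternating c v).
Variables (f : filling n) (x1 x2 : 'I_n).
Hypotheses (nx : x1 != x2) (cx : c x1 = c x2) (fx : f x1 = f x2).
Let t := tperm x1 x2.

Let ft : precomp f t = f.
Proof. by apply/ffunP => z; rewrite ffunE; case: tpermP => // ->. Qed.

Let ct z : c (t z) = c z.
Proof. by rewrite /t; case: tpermP => // ->. Qed.

Let altt h : v (precomp h t) = - v h.
Proof. by rewrite alt ?sgp_tperm ?mulN1r //; apply/ffunP => z; rewrite ffunE ct. Qed.

(** The transposition of x1 and x2 fixes both [f] and y; it permutes the terms and reverses their
    signs. *)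
Lemma exchange_doubled j y : y != x1 -> y != x2 ->
  \sum_(x | c x == j) v (precomp f (tperm x y)) = 0.
Proof.
move=> y1 y2; apply: (eq_opp0 two); rewrite -sumrN.
rewrite [LHS](reindex_inj (@perm_inj _ t)) /=.
apply: eq_big => [x|x _]; first by rewrite ct.
have ty : t y = y by rewrite tpermD 1?eq_sym.
by rewrite -{1}ty -tpermJ conjgE tpermV precompM altt precompM ft.
Qed.

(** Terms may be non-zero when [Z] contains exactly one of x1 and x2; exchanging these two boxes
    pairs such terms with opposite signs. *)
Lemma psi_doubled j j' b :
  \sum_(Z : {set 'I_n} | (Z \subset [set x | f x == j]) && (#|Z| == b))
     v (upd f Z j') = 0.
Proof.
apply: (eq_opp0 two); rewrite -sumrN.
pose tset (Z : {set 'I_n}) := t @^-1: Z.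
have tt : involutive tset by move=> Z; apply/setP => x; rewrite !inE tpermK.
rewrite [LHS](reindex_inj (inv_inj tt)) /tset /=.
apply: eq_big => [Z|Z _]; last by rewrite -altt precomp_upd ft.
rewrite card_preimset; last exact: perm_inj.
congr andb; have fE z : f (t z) = f z by rewrite -{2}ft ffunE.
apply/subsetP/subsetP => H z.
  by move=> zZ; have := H (t z); rewrite !inE tpermK fE => ->.
by rewrite inE => /H; rewrite !inE fE.
Qed.

End Doubled.

(** Applied with [S] the tail, where by symmetry only the number of chosen boxes matters. The
    binomial counts the choices of [Z :&: S]. *)
Lemma sum_by_body (K : fieldType) n (S E : {set 'I_n}) b (G Gp : {set 'I_n} -> K) :
    (forall Z : {set 'I_n}, Z \subset E -> #|Z| = b -> G Z = Gp (Z :\: S)) ->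
  \sum_(Z : {set 'I_n} | (Z \subset E) && (#|Z| == b)) G Z =
  \sum_(Y : {set 'I_n} | (Y \subset E :\: S) && (#|Y| <= b)%N)
     'C(#|E :&: S|, b - #|Y|)%:R * Gp Y.
Proof.
move=> GE.
rewrite (partition_big (fun Z : {set 'I_n} => Z :\: S)
  (fun Y : {set 'I_n} => (Y \subset E :\: S) && (#|Y| <= b)%N)) /=; last first.
  by move=> Z /andP[ZE /eqP <-]; rewrite setSD // subset_leq_card // subsetDl.
apply: eq_bigr => Y /andP[YE leY].
have /subsetDP[/subsetP YE1 dYS] := YE.
rewrite (eq_bigr (fun=> Gp Y)) => [|Z /andP[/andP[ZE /eqP cZ] /eqP <-]]; last exact: GE.
rewrite sumr_const mulr_natl; congr (_ *+ _).
rewrite -(cards_draws (E :&: S)) -[RHS](card_in_imset (f := fun T => Y :|: T)); last first.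
  move=> T1 T2; rewrite !inE => /andP[/subsetP s1 _] /andP[/subsetP s2 _] /setP e.
  apply/setP => x; have := e x; rewrite !inE; case xY: (x \in Y) => //= _.
  have nxS := disjointFr dYS xY.
  apply/idP/idP => [/s1|/s2]; by rewrite inE nxS andbF.
apply: eq_card => Z; apply/idP/imsetP.
  move=> /andP[/andP[ZE /eqP cZ] /eqP eY]; exists (Z :&: S); last first.
    by rewrite -eY setUC setID.
  by rewrite inE setSI // -eY -cZ -(cardsID S Z) addnK eqxx.
case=> T; rewrite inE => /andP[/subsetIP[TE TS] /eqP cT] ->.
have dYT : Y :&: T = set0.
  apply/eqP; rewrite setI_eq0; apply: disjointWr dYS; exact: TS.
rewrite unfold_in /= subUset TE andbT cardsU dYT cards0 subn0 cT subnKC // eqxx andbT.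
apply/andP; split; first by apply/subsetP.
rewrite setDUl; have /setDidPl -> := dYS.
by move: TS; rewrite -setD_eq0 => /eqP ->; rewrite setU0.
Qed.

Lemma upd_tail_eq n (S Z Z' : {set 'I_n}) (U : filling n) i i' :
    (forall x, x \in Z -> U x = i) -> (forall x, x \in Z' -> U x = i) ->
    #|S :&: Z| = #|S :&: Z'| -> Z :\: S = Z' :\: S ->
  (forall x, x \notin S -> upd U Z i' x = upd U Z' i' x) /\
  (forall a, tcnt S (upd U Z i') a = tcnt S (upd U Z' i') a).
Proof.
move=> Zi Zi' cZ /setP eZ; split=> [x xS|a].
  by rewrite !ffunE; have := eZ x; rewrite !inE xS => /= ->.
have := tcnt_upd S i' a Zi; have := tcnt_upd S i' a Zi'; rewrite cZ => <-.
by move/eqP; rewrite eqn_add2r => /eqP.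
Qed.

(** By Vandermonde the difference is a combination of 'C(k p^d, i) with 0 < i <= w. Since p^d
    divides i 'C(k p^d, i) and i < p^d, the prime p divides the binomial. *)
Lemma bin_add_pexp (K : fieldType) p k d t w : prime p -> p \in [pchar K] ->
  (w < p ^ d)%N -> 'C(t + k * p ^ d, w)%:R = 'C(t, w)%:R :> K.
Proof.
move=> pp pK lt.
have dvdC i : (0 < i <= w)%N -> (p %| 'C(k * p ^ d, i))%N.
  case: i => // i /andP[_ leiw].
  have e : (p ^ d %| i.+1 * 'C(k * p ^ d, i.+1))%N.
    by rewrite -mul_bin_diag -mulnA dvdn_mull // dvdn_mulr.
  apply: contraLR (leq_ltn_trans leiw lt) => nd; rewrite -leqNgt.
  have co : coprime (p ^ d) 'C(k * p ^ d, i.+1) by rewrite coprimeXl // prime_coprime.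
  by rewrite dvdn_leq // -(Gauss_dvdl _ co).
rewrite addnC -binomial.Vandermonde big_ord_recl /= bin0 mul1n subn0 natrD natr_sum.
rewrite big1 ?addr0 //.
move=> i _; apply/eqP; rewrite -(dvdn_pcharf pK) dvdn_mulr // dvdC //=.
Qed.

(* A column of [mu] beyond column q = mu_2 is a single box of the first row;  *)
(* (r', c') is (r, c) with m more such boxes.                                 *)
Section Extension.
Variables (K : fieldType) (n m q M L : nat).
Variables (r c : filling n) (r' c' : filling (n + m)).
Hypotheses (two : (2%:R : K) != 0) (D : diagram r c) (D' : diagram r' c').
Hypothesis r'L : forall x, r' (lshift m x) = r x.
Hypothesis r'R : forall y, r' (rshift n y) = 0%N.
Hypothesis c'L : forall x, c' (lshift m x) = c x.
Hypothesis c'R : forall y, c' (rshift n y) = (M + y)%N.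
Hypotheses (qM : (q <= M)%N) (qL : (q <= L)%N).
Hypothesis tail_row : forall x, (q <= c x)%N -> r x = 0%N.

Let tl := [set x | (q <= c x)%N].
Let tl' := [set x | (q <= c' x)%N].

Lemma tlL x : (lshift m x \in tl') = (x \in tl).
Proof. by rewrite !inE c'L. Qed.

Lemma tlR y : rshift n y \in tl'.
Proof. by rewrite inE c'R; apply: leq_trans qM (leq_addr _ _). Qed.

Lemma tail_inj x y : x \in tl -> c x = c y -> x = y.
Proof. by rewrite inE => qx e; apply: (diag_inj D); rewrite ?tail_row // -e. Qed.

Lemma tail_inj' x y : x \in tl' -> c' x = c' y -> x = y.
Proof.
have row0 z : (q <= c' z)%N -> r' z = 0%N.
  by case: (split_ordP z) => u ->; rewrite ?r'R // c'L r'L => /tail_row.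
by rewrite inE => qx e; apply: (diag_inj D') => //; rewrite !row0 // -e.
Qed.

Lemma tcnt_tl' f a :
  tcnt tl' f a = (tcnt tl (restr f) a + \sum_(y < m) (f (rshift n y) == a))%N.
Proof.
rewrite tcnt_split; congr addn; last by apply: eq_bigl => y; rewrite tlR.
by apply: eq_bigl => x; rewrite inE tlL.
Qed.

Lemma tcnt_bd' (f : filling (n + m)) a : tcnt (~: tl') f a = tcnt (~: tl) (restr f) a.
Proof.
rewrite tcnt_split big_pred0 ?addn0; last by move=> y; rewrite inE tlR.
by apply: eq_bigl => x; rewrite !inE c'L.
Qed.

(* Up to the order of the tail entries, [f] is [fh] with m zeros added. *)
Definition hat (f : filling (n + m)) (fh : filling n) :=
  (forall x, x \notin tl -> f (lshift m x) = fh x) /\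
  (forall a, tcnt tl' f a = tcnt tl fh a + m * (a == 0))%N.

Lemma hat_restr (f : filling (n + m)) g : perm_on tl' g ->
  (forall y, f (g (rshift n y)) = 0%N) -> hat f (restr (precomp f g)).
Proof.
move=> gt z; split=> [x xt|a].
  by rewrite !ffunE (out_perm gt) // tlL.
rewrite -(tcnt_perm _ _ gt) tcnt_tl'; congr addn.
under eq_bigr do rewrite ffunE z eq_sym.
by rewrite sum_nat_const card_ord.
Qed.

Lemma hat_padz f : hat (padz m f) f.
Proof.
rewrite -{2}(restr_padz m f) -{2}(precomp1 (padz m f)); apply: hat_restr.
  exact: perm_on1.
by move=> y; rewrite perm1 padzR.
Qed.

Definition pulled (f : filling (n + m)) (g : 'S_(n + m)) :=
  perm_on tl' g && [forall y, f (g (rshift n y)) == 0%N].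

(** Choose [g] bringing as many zeros as possible to the new boxes. If one of these had a non-zero
    entry, the count would leave a zero in the old tail to exchange with it. *)
Lemma pull_zeros (f : filling (n + m)) : (m <= tcnt tl' f 0)%N -> exists g, pulled f g.
Proof.
move=> le; have p1 : perm_on tl' (1%g : 'S_(n + m)) by exact: perm_on1.
have [g gt gmax] := @arg_maxnP _ 1%g (perm_on tl')
   (fun g : 'S_(n + m) => \sum_(y < m) (f (g (rshift n y)) == 0%N))%N p1.
exists g; rewrite /pulled gt; apply/forallP => y; apply: contraT => ny.
move: le; rewrite -(tcnt_perm _ _ gt) tcnt_tl' => le.
have [x xt fx] : exists2 x, x \in tl & f (g (lshift m x)) = 0%N.
  have : (0 < tcnt tl (restr (precomp f g)) 0)%N.
    have lt : (\sum_(y < m) (precomp f g (rshift n y) == 0%N) < m)%N.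
      rewrite (bigD1 y) //= ffunE (negPf ny) add0n.
      apply: (@leq_ltn_trans (\sum_(i < m | i != y) 1)%N).
        by apply: leq_sum => i _; case: eqP.
      by rewrite sum1_card cardC1 card_ord prednK // (leq_ltn_trans _ (ltn_ord y)).
    move: (leq_trans lt le); move: (tcnt _ _ _) (\sum_(y < m) _)%N => [|a] b //.
    by rewrite add0n ltnn.
  rewrite tcnt_card card_gt0 => /set0Pn[x]; rewrite !inE !ffunE => /andP[xt /eqP fx].
  by exists x; rewrite ?inE.
have gt2 : perm_on tl' (tperm (lshift m x) (rshift n y) * g)%g.
  by rewrite perm_onM // tperm_on_set ?tlL ?tlR.
have := gmax _ gt2; rewrite /= (bigD1 y) // [X in (_ <= X)%N](bigD1 y) //=.
rewrite permM tpermR fx (negPf ny) /= add0n add1n.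
rewrite (eq_bigr (fun z => (f (g (rshift n z)) == 0%N) : nat)) ?ltnn //.
move=> z zy; rewrite permM tpermD ?eq_lrshift //.
by rewrite (inj_eq (@rshift_inj _ _)) eq_sym.
Qed.

Lemma hat_exists (f : filling (n + m)) : (m <= tcnt tl' f 0)%N -> exists fh, hat f fh.
Proof.
move=> /pull_zeros[g /andP[gt /forallP z]].
by exists (restr (precomp f g)); apply: hat_restr => // y; apply/eqP.
Qed.

Lemma hat_zeros f fh : hat f fh -> (m <= tcnt tl' f 0)%N.
Proof. by case=> _ ->; rewrite muln1 leq_addl. Qed.

(** The two clauses together determine [v'] from [v]. For a function attached to the larger pair the
    second is forced by [tail_zeros']. *)
Definition lifts (v : filling n -> K) (v' : filling (n + m) -> K) :=
  (forall f fh, hat f fh -> v' f = v fh) /\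
  (forall f, (tcnt tl' f 0 < m)%N -> v' f = 0).

Definition ext (v : filling n -> K) (f : filling (n + m)) : K :=
  if [pick g | pulled f g] is Some g then v (restr (precomp f g)) else 0.

(** The choice of [g] is immaterial: two fillings obtained from [f] by deleting m zeros differ only
    in the order of the tail, to which [v] is insensitive. *)
Lemma lifts_ext v : symmetric_on tl v -> lifts v (ext v).
Proof.
move=> sym; split=> f => [fh hf|lt]; rewrite /ext; case: pickP => [g pg|no].
- move: (pg) => /andP[gt /forallP z].
  have [off cnt] := hat_restr gt (fun y => eqP (z y)); case: hf => off2 cnt2.
  apply: (tcnt_sym sym) => [x xt|a]; first by rewrite -off // off2.
  by apply/eqP; rewrite -(eqn_add2r (m * (a == 0%N))) -cnt -cnt2.
- by have [g pg] := pull_zeros (hat_zeros hf); rewrite no in pg.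
- move: pg => /andP[gt /forallP z].
  by have := hat_zeros (hat_restr gt (fun y => eqP (z y))); rewrite leqNgt lt.
- by [].
Qed.

Lemma tail_fixed' (s : 'S_(n + m)) : precomp c' s = c' -> forall x, x \in tl' -> s x = x.
Proof.
move=> /ffunP cs x xt; apply/esym/tail_inj' => //.
by have := cs x; rewrite ffunE => ->.
Qed.

Lemma colstab_emb s : (precomp c' s == c') -> exists2 g, s = emb m g & precomp c g = c.
Proof.
move=> /eqP cs; have [g eg] := emb_surj (fun y => tail_fixed' cs (tlR y)).
exists g => //; apply/ffunP => x; rewrite ffunE.
by move/ffunP: cs => /(_ (lshift m x)); rewrite ffunE eg embL !c'L.
Qed.

Lemma emb_colstab g : (precomp c' (emb m g) == c') = (precomp c g == c).
Proof.
apply/eqP/eqP => [/eqP/colstab_emb[h /emb_inj -> //]|/ffunP e].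
apply/ffunP => x; rewrite ffunE; case: (split_ordP x) => y ->; last by rewrite embR.
by have := e y; rewrite embL ffunE !c'L.
Qed.

Lemma hat_emb f fh (g : 'S_n) : (forall x, x \in tl -> g x = x) -> hat f fh ->
  hat (precomp f (emb m g)) (precomp fh g).
Proof.
move=> gf [off cnt].
have gt x : x \notin tl -> g x \notin tl.
  by move=> xt; apply: contra xt => gx; rewrite -(perm_inj (gf _ gx)).
split=> [x xt|a]; first by rewrite !ffunE embL off // gt.
have -> : tcnt tl (precomp fh g) a = tcnt tl fh a.
  by apply: eq_bigr => x xt; rewrite ffunE gf.
rewrite -cnt; apply: eq_bigr => x; rewrite ffunE.
by case: (split_ordP x) => y ->; rewrite ?embR // embL tlL => /gf ->.
Qed.

Lemma hat_tail_tperm f fh x y : x \in tl' -> y \in tl' -> hat f fh ->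
  hat (precomp f (tperm x y)) fh.
Proof.
move=> xt yt [off cnt]; split=> [z zt|a]; last by rewrite tcnt_perm ?tperm_on_set.
rewrite ffunE tpermD ?off //.
  by apply: contraNneq zt => e; rewrite -tlL -e.
by apply: contraNneq zt => e; rewrite -tlL -e.
Qed.

(** The box y may be new, or its entry may sit elsewhere in [fh]; a tail box [yh] of [fh] with the
    same entry takes its place. *)
Lemma hat_tperm (f : filling (n + m)) (fh : filling n) x y yh :
    x \notin tl -> y \in tl' -> yh \in tl -> f y = fh yh ->
  hat f fh -> hat (precomp f (tperm (lshift m x) y)) (precomp fh (tperm x yh)).
Proof.
move=> xt yt yht e [off cnt]; split=> [z zt|a].
  rewrite !ffunE; have zy : y != lshift m z by apply: contraNneq zt => e'; rewrite -tlL -e'.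
  have zyh : yh != z by apply: contraNneq zt => <-.
  have [->|nzx] := eqVneq z x; first by rewrite !tpermL.
  by rewrite !tpermD // ?(inj_eq (@lshift_inj _ _)) 1?eq_sym ?off // eq_sym.
have c1 := @tcnt_tperm _ tl' f (lshift m x) y a; have c2 := @tcnt_tperm _ tl fh x yh a.
rewrite tlL off // e in c1; have := c1 xt yt; have := c2 xt yht; rewrite cnt.
by move=> e1 e2; apply/eqP; rewrite -(eqn_add2r (fh yh == a)) e2 [X in _ == X]addnAC e1 addnAC.
Qed.

Lemma lifts_alternating v v' : lifts v v' -> alternating c v -> alternating c' v'.
Proof.
move=> [l1 l2] alt s f /eqP cs; have [g -> cg] := colstab_emb cs.
have gf x : x \in tl -> g x = x.
  by move=> xt; apply/esym/tail_inj => //; move/ffunP: cg => /(_ x); rewrite ffunE.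
have [lt|le] := ltnP (tcnt tl' f 0) m.
  rewrite !l2 ?mulr0 //; apply: leq_ltn_trans lt; apply: eq_leq.
  apply: eq_bigr => x; rewrite ffunE.
  by case: (split_ordP x) => y ->; rewrite ?embR // embL tlL => /gf ->.
have [fh hf] := hat_exists le.
by rewrite (l1 _ _ hf) (l1 _ _ (hat_emb gf hf)) alt // odd_emb.
Qed.

Lemma tcnt_hat f fh a : hat f fh -> tcnt setT f a = (tcnt setT fh a + m * (a == 0%N))%N.
Proof.
move=> [off cnt]; rewrite (tcntID tl') (tcntID tl) cnt tcnt_bd' addnAC; congr addn.
congr addn; apply: eq_bigr => x; rewrite inE ffunE => xt.
by rewrite off.
Qed.

Lemma lifts_supp v v' f : lifts v v' -> v' f != 0 -> exists2 fh, hat f fh & v fh != 0.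
Proof.
move=> [l1 l2] nz; have [/l2 e|/hat_exists[fh hf]] := ltnP (tcnt tl' f 0) m.
  by rewrite e eqxx in nz.
by exists fh; rewrite -?(l1 _ _ hf).
Qed.

Definition col_distinct_zeros N (d f : filling N) :=
  [forall x, forall y, [&& x != y, d x == d y, f x == 0%N & f y == 0%N] ==> false].

Lemma col_distinct_zerosP N (d f : filling N) :
  reflect (forall x y, d x = d y -> f x = 0%N -> f y = 0%N -> x = y)
          (col_distinct_zeros d f).
Proof.
apply: (iffP forallP) => [H x y dxy fx fy|H x].
  have /forallP/(_ y) := H x; rewrite dxy fx fy !eqxx implybF !andbT negbK.
  by move/eqP.
apply/forallP => y; apply/implyP => /and4P[nxy /eqP dxy /eqP fx /eqP fy].
by rewrite (H x y) ?eqxx in nxy.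
Qed.

(** There are only q columns before the tail. The case of equality is what the critical case of
    [lifts_exchange] relies on. *)
Lemma body_zeros N (d f : filling N) : col_distinct_zeros d f ->
  let S := ~: [set x | (q <= d x)%N] in
  (tcnt S f 0 <= q)%N /\
  ((q <= tcnt S f 0)%N -> forall j, (j < q)%N -> exists2 x, d x = j & f x = 0%N).
Proof.
move=> /col_distinct_zerosP dz S.
have := @inj_count _ [set x in S | f x == 0%N] d q; rewrite -tcnt_card; case.
- by move=> x y; rewrite !inE => /andP[_ /eqP fx] /andP[_ /eqP fy] e; apply: dz.
- by move=> x; rewrite !inE -ltnNge => /andP[].
move=> le H; split=> // /H{}H j /H[x]; rewrite !inE => /andP[_ /eqP fx] dx.
by exists x.
Qed.

Definition zero_weight (v : filling n -> K) := forall f, v f != 0 -> tcnt setT f 0 = L.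

Lemma lifts_zero_weight v v' f : lifts v v' -> zero_weight v -> v' f != 0 ->
  tcnt setT f 0 = (L + m)%N.
Proof.
by move=> lf zw /(lifts_supp lf)[fh hf /zw e]; rewrite (tcnt_hat _ hf) e muln1.
Qed.

Lemma alternating_distinct N (d : filling N) (v : filling N -> K) f :
  alternating d v -> v f != 0 -> col_distinct_zeros d f.
Proof.
move=> alt nz; apply/col_distinct_zerosP => x y dxy fx fy; apply/eqP.
by apply: contraNT nz => nxy; rewrite (alternating_eq0 two alt nxy) ?fx.
Qed.

(** At most q = mu_2 zeros lie outside the tail, and q <= L, where [L] stands for la_1. *)
Lemma tail_zeros' f : col_distinct_zeros c' f -> tcnt setT f 0 = (L + m)%N ->
  (m <= tcnt tl' f 0)%N.
Proof.
move=> /body_zeros[le _] e; move: e le qL; rewrite (tcntID tl') -/tl'.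
by move: (tcnt tl' f 0) (tcnt (~: tl') f 0) => a b; lia.
Qed.

(** The essential case has j < q, distinct zeros in columns and L + m zeros in all. If the entry of
    y survives in the tail after m zeros are deleted, the relation is one for [v]. Otherwise y holds
    0, the tail has exactly m zeros, and column j contains one 0: exchanging y with it changes
    nothing, while any other exchange leaves fewer than m zeros in the tail. *)
Lemma lifts_exchange v v' f j y : representable r c v -> zero_weight v -> lifts v v' ->
    y \in tl' -> (j < c' y)%N ->
  v' f = \sum_(x | c' x == j) v' (precomp f (tperm x y)).
Proof.
move=> rep zw lf yt ltj.
have alt := lifts_alternating lf (representable_alternating rep).
have [l1 l2] := lf.
have [qj|jq] := leqP q j.
  have [x rx cx] := diag_left D' ltj.
  have xt : x \in tl' by rewrite inE cx.
  rewrite (big_pred1 x) => [|z /=]; last first.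
    by apply/eqP/eqP => [e|-> //]; apply/esym/(tail_inj' xt); rewrite cx.
  have [lt|/hat_exists[fh hf]] := ltnP (tcnt tl' f 0) m.
    by rewrite !l2 // tcnt_perm // tperm_on_set.
  by rewrite (l1 _ _ hf) (l1 _ _ (hat_tail_tperm xt yt hf)).
have [dz|] := boolP (col_distinct_zeros c' f); last first.
  rewrite negb_forall => /existsP[x1]; rewrite negb_forall => /existsP[x2].
  rewrite implybF negbK => /and4P[nx /eqP cx /eqP f1 /eqP f2].
  have fx : f x1 = f x2 by rewrite f1.
  rewrite (alternating_eq0 two alt nx cx fx) (exchange_doubled two alt nx cx fx) //.
    by apply: contraNneq nx => e; apply/eqP/tail_inj' => //; rewrite -e.
  by apply: contraNneq nx => e; apply/eqP/esym/tail_inj' => //; rewrite -e.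
have [tot|ntot] := eqVneq (tcnt setT f 0) (L + m)%N; last first.
  have z g : v' (precomp f g) = 0.
    apply/eqP; apply: contraNT ntot => /(lifts_zero_weight lf zw).
    by rewrite tcnt_perm ?perm_onT // => ->.
  by rewrite big1 => [|x _]; rewrite ?z // -(precomp1 f) z.
have [fh hf] := hat_exists (tail_zeros' dz tot).
have bodyL x : c x = j -> x \notin tl by move=> e; rewrite inE e -ltnNge.
have [pos|] := boolP (0 < tcnt tl fh (f y))%N.
  have [yh yht fyh] : exists2 yh, yh \in tl & fh yh = f y.
    move: pos; rewrite tcnt_card card_gt0 => /set0Pn[yh].
    by rewrite inE => /andP[? /eqP]; exists yh.
  have ltyh : (j < c yh)%N by move: yht; rewrite inE; apply: leq_trans.
  rewrite (l1 _ _ hf) (representable_exchange two D fh rep ltyh).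
  rewrite [RHS]big_split_ord /= [X in _ = _ + X]big_pred0 ?addr0; last first.
    by move=> z; apply: contraTF (tlR z) => /eqP e; rewrite inE e -ltnNge.
  apply: eq_big => [x|x /eqP cx]; first by rewrite c'L.
  by rewrite (l1 _ _ (hat_tperm (bodyL x cx) yt yht (esym fyh) hf)).
have [_ cnt] := hf; rewrite -eqn0Ngt => /eqP t0.
have fy0 : f y = 0%N.
  apply/eqP; apply/negPn/negP => ny; have := cnt (f y).
  rewrite t0 (negPf ny) muln0 addn0 tcnt_card => /eqP; rewrite cards_eq0 => /eqP/setP/(_ y).
  by rewrite !inE eqxx andbT; move: yt; rewrite inE => ->.
have tm : tcnt tl' f 0 = m by rewrite cnt -{1}fy0 t0 muln1.
have [_ full] := body_zeros dz; rewrite -/tl' in full.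
(* Outside the tail there remain L >= q zeros, so each of the q columns there contains one. *)
have [|x0 cx0 fx0] := full _ j jq.
  by move: tot qL; rewrite (tcntID tl') tm; move: (tcnt _ _ _) => b; lia.
have f0 : precomp f (tperm x0 y) = f.
  by apply/ffunP => z; rewrite ffunE; case: tpermP => [->|->|//]; rewrite fx0 fy0.
rewrite (bigD1 x0) ?cx0 //= f0 big1 ?addr0 // => x /andP[/eqP cx nx].
apply: l2; have xt : x \notin tl' by rewrite inE cx -ltnNge.
have fx : f x != 0%N.
  apply: contraNneq nx => fx; apply/eqP; move/col_distinct_zerosP: dz; apply=> //.
  by rewrite cx.
have := tcnt_tperm f 0 xt yt; rewrite fy0 (negPf fx) eqxx tm addn0 addn1 => e.
by apply: eq_leq.
Qed.

Lemma lshift_body (S : {set 'I_(n + m)}) : S \subset ~: tl' ->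
  lshift m @: [set x | lshift m x \in S] = S.
Proof.
move=> /subsetP sub; apply/setP => z; case: (split_ordP z) => x ->.
  by rewrite mem_imset ?inE //; apply: lshift_inj.
rewrite [RHS](_ : _ = false); last first.
  by apply/negP => /sub; rewrite inE tlR.
by apply/imsetP => -[u _ /esym/eqP]; rewrite eq_lrshift.
Qed.

Lemma upd_lshift a (U : filling n) (U' : filling (n + m)) (Z : {set 'I_n}) x :
  (forall x, U' (lshift m x) = U x) -> upd U' (lshift m @: Z) a (lshift m x) = upd U Z a x.
Proof. by move=> e; rewrite !ffunE mem_imset ?e //; apply: lshift_inj. Qed.

(** Neither column belongs to the tail, so the tail entries stay in place: either every term
    vanishes for lack of zeros in the tail, or the relation is the one for [v]. *)
Lemma lifts_garnir_body v v' f j (B : {set 'I_(n + m)}) :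
    representable r c v -> zero_weight v -> lifts v v' -> (j.+1 < q)%N ->
    B \subset [set x | c' x == j.+1] -> B != set0 ->
  \sum_(Z : {set 'I_(n + m)} |
          (Z \subset [set x | upd c' B j x == j]) && (#|Z| == #|B|))
     colform c' v' f (upd (upd c' B j) Z j.+1) = 0.
Proof.
move=> rep zw lf jq Bsub B0.
have alt := representable_alternating rep.
have alt' := lifts_alternating lf alt.
have [l1 l2] := lf.
have [lt|/hat_exists[fh hf]] := ltnP (tcnt tl' f 0) m.
  apply: big1 => Z _; rewrite /colform; case: pickP => // g /eqP/ffunP hg.
  rewrite l2 ?mulr0 //; apply: leq_ltn_trans lt; apply: eq_leq; apply: eq_bigr => x xt.
  rewrite ffunE; congr (nat_of_bool (f _ == _)); apply/esym/tail_inj' => //.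
  have := hg x; rewrite !ffunE; move: xt; rewrite inE; case: ifP => _.
    by move=> + e; rewrite -e; lia.
  by case: ifP => _ // + e; rewrite -e; lia.
have Bbody : B \subset ~: tl'.
  by apply: subset_trans Bsub _; apply/subsetP => x; rewrite !inE -ltnNge => /eqP ->.
pose B1 := [set x | lshift m x \in B].
have eB : B = lshift m @: B1 by rewrite lshift_body.
have cB : #|B| = #|B1| by rewrite eB card_imset //; apply: lshift_inj.
have UE x : upd c' B j (lshift m x) = upd c B1 j x by rewrite eB; apply: upd_lshift.
rewrite (reindex_onto (fun Z : {set 'I_n} => lshift m @: Z)
           (fun Z => [set x | lshift m x \in Z])) /=; last first.
  move=> Z /andP[/subsetP sub _]; apply: lshift_body; apply/subsetP => x /sub.
  rewrite !inE ffunE; case: ifP => [/(subsetP Bbody)|_ /eqP ->]; first by rewrite !inE.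
  by rewrite -ltnNge ltnW.
have B1sub : B1 \subset [set x | c x == j.+1].
  by apply/subsetP => x; rewrite !inE => /(subsetP Bsub); rewrite inE c'L.
have B1pos : (0 < #|B1|)%N by rewrite -cB card_gt0.
rewrite -[RHS](@representable_psi _ _ _ _ two D v fh j j.+1 rep (ltnSn j)
  (upd c B1 j) _ B1pos).
apply: eq_big => [Z|Z].
  rewrite card_imset; last exact: lshift_inj.
  have -> : [set x | lshift m x \in lshift m @: Z] == Z.
    by apply/eqP/setP => x; rewrite inE mem_imset //; apply: lshift_inj.
  rewrite andbT cB; congr andb; apply/subsetP/subsetP => H x.
    by move=> xZ; have := H (lshift m x); rewrite !inE mem_imset ?UE;
       [apply | exact: lshift_inj].
  by case/imsetP=> z zZ ->; have := H _ zZ; rewrite !inE UE.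
rewrite card_imset; last exact: lshift_inj.
move=> /andP[/andP[/subsetP Zsub /eqP cZ] _].
set h0 := upd (upd c B1 j) Z j.+1; set h := upd (upd c' B j) (lshift m @: Z) j.+1.
have hE x : h (lshift m x) = h0 x by apply: upd_lshift.
have hR y : h (rshift n y) = c' (rshift n y).
  rewrite ffunE ifF; last by apply/imsetP => -[u _ /esym/eqP]; rewrite eq_lrshift.
  rewrite ffunE ifF //; apply/negP => /(subsetP Bbody); by rewrite inE tlR.
(* Moving [B1] to column j and then equally many boxes [Z] back to column j+1 restores all column
   sizes. *)
have [g0 _ hg0] : exists2 g0, perm_on setT g0 & precomp h0 g0 = c.
  apply: tcnt_perm_ex => [x|a]; first by rewrite inE.
  have Zj x : x \in Z -> upd c B1 j x = j.
    move=> xZ; have := Zsub (lshift m x); rewrite mem_imset; last exact: lshift_inj.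
    by rewrite inE UE => /(_ xZ)/eqP.
  have Bj x : x \in B1 -> c x = j.+1 by move/(subsetP B1sub); rewrite inE => /eqP.
  have := tcnt_upd setT j.+1 a Zj; have := tcnt_upd setT j a Bj.
  rewrite !setTI cZ cB -/h0.
  move: (tcnt _ h0 a) (tcnt _ (upd c B1 j) a) (tcnt _ c a) (#|B1| * _)%N (#|B1| * _)%N.
  by move=> *; lia.
have hg : precomp h (emb m g0) = c'.
  apply/ffunP => x; rewrite ffunE; case: (split_ordP x) => y ->; rewrite ?embR //.
  by rewrite embL hE c'L; move/ffunP: hg0 => /(_ y); rewrite ffunE.
rewrite (colformE _ alt' hg) (colformE _ alt hg0) odd_emb; congr (_ * _).
apply: l1; apply: hat_emb hf => x xt; apply/esym/tail_inj => //.
move/ffunP: hg0 => /(_ x); rewrite ffunE => e.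
move: e xt; rewrite inE /h0 !ffunE; case: ifP => _; first by move=> <-; lia.
by case: ifP => // _ <-; lia.
Qed.

(** When column j+1 lies in the tail it has a single box, and its Garnir relation reduces to
    [lifts_exchange]. *)
Lemma lifts_representable v v' : representable r c v -> zero_weight v -> lifts v v' ->
  representable r' c' v'.
Proof.
move=> rep zw lf; have alt' := lifts_alternating lf (representable_alternating rep).
apply: (garnir_representable two D' alt') => f j B Bsub B0.
have [jq|qj] := ltnP j.+1 q; first exact: lifts_garnir_body.
have [y yB] := set0Pn _ B0.
have cy : c' y = j.+1 by have := subsetP Bsub _ yB; rewrite inE => /eqP.
have yt : y \in tl' by rewrite inE cy.
have -> : B = [set y].
  apply/setP => z; rewrite inE; apply/idP/eqP => [zB|-> //].
  apply/esym/tail_inj' => //; rewrite cy.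
  by have := subsetP Bsub _ zB; rewrite inE => /eqP.
rewrite cards1 -cy colform_exchange_sum // ?cy ?gtn_eqF //.
by rewrite -(lifts_exchange f rep zw lf yt) ?subrr // cy.
Qed.

Lemma padz_r : r' = padz m r.
Proof.
apply/ffunP => x; case: (split_ordP x) => y ->.
  by rewrite padzL r'L.
by rewrite padzR r'R.
Qed.

(** The new columns have one box each, so the column stabiliser of the larger diagram is the
    embedded image of the smaller one. *)
Lemma res_representable (v' : filling (n + m) -> K) : representable r' c' v' ->
  representable r c (fun f => v' (padz m f)).
Proof.
move=> rep f; have [w Hw] := rep (padz m f); exists (fun t => w (padz m t)) => g.
rewrite padz_emb Hw.
rewrite (eq_bigl (mem (emb m @: [set s | precomp c s == c]))) => [|s /=]; last first.
  apply/idP/imsetP => [/colstab_emb[g0 -> /eqP cg]|[g0]]; first by exists g0; rewrite ?inE.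
  by rewrite inE => cg ->; rewrite emb_colstab.
rewrite big_imset /=; last by move=> s t _ _; apply: emb_inj.
apply: eq_big => [s|s _]; first by rewrite inE.
by rewrite odd_emb -embM -embV padz_r padz_emb.
Qed.

(** Symmetry in the tail brings m zeros to the new boxes if there are that many; otherwise
    alternation and weight force the value 0. Hence [v'] is determined by its values at padded
    fillings. *)
Lemma lifts_res (v' : filling (n + m) -> K) : representable r' c' v' ->
    (forall f, v' f != 0 -> tcnt setT f 0 = (L + m)%N) ->
  lifts (fun f => v' (padz m f)) v'.
Proof.
move=> rep zw; split=> [f fh hf|f lt].
  apply: (tcnt_sym (representable_symmetric_on two D' tail_inj' rep)) => [x xt|a].
    move: xt; case: (split_ordP x) => y ->; last by rewrite tlR.
    by rewrite tlL padzL => /(proj1 hf).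
  by rewrite (proj2 hf) (proj2 (hat_padz fh)).
apply/eqP; apply: contraTT lt => nz; rewrite -leqNgt.
apply: tail_zeros' (zw _ nz); apply: alternating_distinct nz.
exact: representable_alternating rep.
Qed.

(** * Comparison of the exchange conditions for la and la + (m) *)

Section Psi.
Variables (P0 L1 : nat) (v : filling n -> K) (v' : filling (n + m) -> K).
Hypothesis cM : forall x, (c x < M)%N.
Hypothesis binP0 : forall t w, (w < P0)%N -> 'C(t + m, w)%:R = 'C(t, w)%:R :> K.
Hypothesis minP0 : (minn L1 (M - L) < P0)%N.
Hypotheses (rep : representable r c v) (lf : lifts v v').
Hypothesis zw : zero_weight v.
Hypothesis ow : forall f, v f != 0 -> tcnt setT f 1 = L1.

Let alt := representable_alternating rep.
Let alt' := lifts_alternating lf alt.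

(** Here [P0] is p^d, [L1] is la_2 and [M - L] is mu_1 - la_1. At a non-zero value, #|T| <= la_2 by
    weight; moreover the la_1 zeros lie in distinct columns, none of them a column of [T], so la_1 +
    #|T| <= mu_1. This is the source of the minimum in the theorem. *)
Lemma many_tail_ones (f : filling n) (T : {set 'I_n}) : T \subset tl ->
  (forall x, x \in T -> f x = 1%N) -> (P0 <= #|T|)%N -> v f = 0.
Proof.
move=> /subsetP Tt T1 le; apply/eqP/negPn/negP => nz.
have /col_distinct_zerosP dz := alternating_distinct alt nz.
have le1 : (#|T| <= L1)%N.
  rewrite -(ow nz) tcnt_card; apply/subset_leq_card/subsetP => x /T1 fx.
  by rewrite !inE fx.
have le2 : (L + #|T| <= M)%N.
  rewrite -(zw nz) tcnt_card.
  have dis : [set x in setT | f x == 0%N] :&: T = set0.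
    by apply/setP => x; rewrite !inE; case xT: (x \in T); rewrite ?andbF ?(T1 x).
  have := cardsUI [set x in setT | f x == 0%N] T; rewrite dis cards0 addn0 => <-.
  apply: (inj_count (c := c) _ _).1 => // x y; rewrite !inE /=.
  case/orP=> [/eqP fx|xT]; last by move=> _; apply: tail_inj (Tt _ xT).
  case/orP=> [/eqP fy|yT] e; first exact: dz.
  by apply/esym/(tail_inj (Tt _ yT)).
by move: minP0; rewrite ltnNge leq_min; case/negP; apply/andP; split; lia.
Qed.

(** Both sums are grouped by the part of [Z] outside the tail. The groups have equal values, and
    their multiplicities differ only for i = 0, where the larger tail offers m more zeros to choose
    from. *)
Lemma psi_compare U Uh i b : hat U Uh -> (i = 0%N -> (b <= tcnt tl Uh 0)%N) ->
  \sum_(Z : {set 'I_(n + m)} | (Z \subset [set x | U x == i]) && (#|Z| == b))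
     v' (upd U Z i.+1) =
  \sum_(Z : {set 'I_n} | (Z \subset [set x | Uh x == i]) && (#|Z| == b))
     v (upd Uh Z i.+1).
Proof.
move=> hU leb; have [off cnt] := hU.
set E' := [set x | U x == i]; set E := [set x | Uh x == i].
have Ei x : x \in E -> Uh x = i by rewrite inE => /eqP.
have Ei' x : x \in E' -> U x = i by rewrite inE => /eqP.
have cE : #|E :&: tl| = tcnt tl Uh i.
  by rewrite tcnt_card; apply: eq_card => x; rewrite !inE andbC.
have cE' : #|E' :&: tl'| = (#|E :&: tl| + m * (i == 0))%N.
  rewrite cE -cnt tcnt_card; apply: eq_card => x; rewrite !inE; exact: andbC.
(* By symmetry the choice of [T] does not matter. The default 0 is never taken at a [Y] that comes
   from some [Z]; for the larger diagram and i = 0 this is guaranteed by [leb]. *)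
pose Gp (Y : {set 'I_n}) :=
  if [pick T : {set 'I_n} | (T \subset E :&: tl) && (#|T| == b - #|Y|)%N] is Some T
  then v (upd Uh (Y :|: T) i.+1) else 0.
have [l1 _] := lf.
have symv : symmetric_on tl v := representable_symmetric_on two D tail_inj rep.
have UT (Y T : {set 'I_n}) : Y \subset E :\: tl -> T \subset E :&: tl ->
    [/\ forall x, x \in Y :|: T -> Uh x = i, #|tl :&: (Y :|: T)| = #|T| &
        (Y :|: T) :\: tl = Y].
  move=> /subsetDP[YE dY] /subsetIP[TE TS]; split.
  - move=> x; rewrite inE => /orP[/(subsetP YE)|/(subsetP TE)]; exact: Ei.
  - rewrite setIUr [tl :&: Y](_ : _ = set0) ?set0U; last first.
      by apply/eqP; rewrite setI_eq0 disjoint_sym.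
    by congr #|pred_of_set _|; apply/setIidPr.
  - rewrite setDUl; have /setDidPl -> := dY.
    by move: TS; rewrite -setD_eq0 => /eqP ->; rewrite setU0.
have GE (Z : {set 'I_n}) : Z \subset E -> #|Z| = b -> v (upd Uh Z i.+1) = Gp (Z :\: tl).
  move=> ZE cZ; have Zi x : x \in Z -> Uh x = i by move/(subsetP ZE)/Ei.
  have cZt : #|tl :&: Z| = (b - #|Z :\: tl|)%N by rewrite -cZ -(cardsID tl Z) addnK setIC.
  rewrite /Gp; case: pickP => [T /andP[TE /eqP cT]|/(_ (Z :&: tl))]; last first.
    by rewrite setSI // setIC cZt eqxx.
  have [Y1 Y2 Y3] := UT _ _ (setSD tl ZE) TE.
  have [o cn] : (forall x, x \notin tl -> upd Uh Z i.+1 x =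
                                upd Uh (Z :\: tl :|: T) i.+1 x) /\
     (forall a, tcnt tl (upd Uh Z i.+1) a = tcnt tl (upd Uh (Z :\: tl :|: T) i.+1) a).
    by apply: (upd_tail_eq (i := i)) => //; rewrite ?Y2 ?Y3 ?cT.
  exact: (tcnt_sym symv).
have GE' (Z : {set 'I_(n + m)}) : Z \subset E' -> #|Z| = b ->
    v' (upd U Z i.+1) = Gp [set x | lshift m x \in Z :\: tl'].
  move=> ZE cZ; have Zi x : x \in Z -> U x = i by move/(subsetP ZE)/Ei'.
  set Y := [set x | _].
  have YE : Y \subset E :\: tl.
    apply/subsetP => x; rewrite 2!inE tlL => /andP[xt xZ]; rewrite inE xt inE -off //.
    by rewrite Zi ?eqxx.
  have cY : #|Y| = #|Z :\: tl'|.
    rewrite -[Z :\: tl']lshift_body -/Y; last by rewrite setDE subsetIr.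
    by rewrite card_imset //; apply: lshift_inj.
  have cZt : #|tl' :&: Z| = (b - #|Y|)%N by rewrite cY -cZ -(cardsID tl' Z) addnK setIC.
  rewrite /Gp; case: pickP => [T /andP[TE /eqP cT]|none].
    have [Y1 Y2 Y3] := UT _ _ YE TE; apply: l1; split=> [x xt|a].
      rewrite !ffunE off // 3!inE tlL xt /= [x \in T](_ : _ = false) ?orbF //.
      by apply: contraNF xt => /(subsetP TE); rewrite inE => /andP[].
    have := tcnt_upd tl' i.+1 a Zi; have := tcnt_upd tl i.+1 a Y1.
    rewrite Y2 cT cZt cnt => e1 e2; apply/eqP.
    rewrite -(eqn_add2r ((b - #|Y|) * (i == a))) e2 addnAC -e1; apply/eqP.
    by rewrite addnAC.
  exfalso; have : (b - #|Y| <= #|E :&: tl|)%N.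
    have [i0|ni] := eqVneq i 0%N.
      by rewrite cE i0; apply: leq_trans (leq_subr _ _) (leb i0).
    rewrite -cZt -[#|E :&: tl|]addn0 -(muln0 m) -[X in (m * X)%N]/(false : nat).
    rewrite -(negPf ni) -cE' setIC; apply: subset_leq_card; exact: setSI.
  rewrite -bin_gt0 -(cards_draws (E :&: tl)) card_gt0 => /set0Pn[T].
  by rewrite inE none.
rewrite (sum_by_body (Gp := fun Y => Gp [set x | lshift m x \in Y]) GE').
rewrite (sum_by_body (Gp := Gp) GE).
rewrite (reindex_onto (fun Z : {set 'I_n} => lshift m @: Z)
           (fun Z => [set x | lshift m x \in Z])) /=; last first.
  move=> Z /andP[/subsetDP[_ dZ] _]; apply: lshift_body.
  by rewrite -disjoints_subset.
have imK (Y : {set 'I_n}) : [set x | lshift m x \in lshift m @: Y] = Y.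
  by apply/setP => x; rewrite inE mem_imset //; apply: lshift_inj.
apply: eq_big => [Y|Y _].
  rewrite imK eqxx andbT card_imset; last exact: lshift_inj.
  congr andb; apply/subsetP/subsetP => H x.
    move=> xY; have := H (lshift m x); rewrite mem_imset; last exact: lshift_inj.
    move=> /(_ xY); rewrite inE tlL => /andP[xt]; rewrite !inE off //.
    by move: xt; rewrite inE => ->.
  case/imsetP=> z /H; rewrite inE => /andP[zt zE] ->; rewrite inE tlL zt inE off //.
  by rewrite Ei ?eqxx.
rewrite imK card_imset; last exact: lshift_inj.
rewrite cE'; have [i0|ni] := eqVneq i 0%N; last by rewrite muln0 addn0.
rewrite muln1; have [lt|ge] := ltnP (b - #|Y|) P0; first by rewrite binP0.
(* The two binomials may differ here, but the filling has at least [P0] single-box columns filled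
   with 1. *)
suff -> : Gp Y = 0 by rewrite !mulr0.
rewrite /Gp; case: pickP => // T /andP[/subsetIP[TE TS] /eqP cT].
apply: (many_tail_ones TS); last by rewrite cT.
by move=> x xT; rewrite ffunE inE xT orbT i0.
Qed.

(** For i = 0 a filling [U] that matters has b zeros more than the fillings in the sum, L + m + b in
    all. If no column repeats a zero, at least m + b of them are in the tail, so b remain there
    after the deletion, as [psi_compare] requires. *)
Lemma lifts_psi i : psi_at v i i.+1 -> psi_at v' i i.+1.
Proof.
move=> psi U b b0.
have [dz|] := boolP (col_distinct_zeros c' U); last first.
  rewrite negb_forall => /existsP[x1]; rewrite negb_forall => /existsP[x2].
  rewrite implybF negbK => /and4P[nx /eqP cx /eqP f1 /eqP f2].
  by apply: (psi_doubled two alt' nx cx); rewrite f1.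
have [tot|ntot] := eqVneq (tcnt setT U 0) (L + m + b * (i == 0))%N; last first.
  apply: big1 => Z /andP[/subsetP ZE /eqP cZ]; apply/eqP; apply: contraNT ntot => nz.
  have Zi x : x \in Z -> U x = i by move/ZE; rewrite inE => /eqP.
  have := tcnt_upd setT i.+1 0 Zi; rewrite (lifts_zero_weight lf zw nz) setTI cZ.
  by rewrite /= muln0 addn0 => <-.
have tz : (m + b * (i == 0) <= tcnt tl' U 0)%N.
  have [le _] := body_zeros dz; move: tot le qL; rewrite (tcntID tl') -/tl'.
  by move: (tcnt tl' U 0) (tcnt (~: tl') U 0) (b * _)%N => u w z; lia.
have [Uh hU] := hat_exists (leq_trans (leq_addr _ _) tz).
rewrite (psi_compare hU) ?psi // => i0.
by move: tz; rewrite (proj2 hU) i0 /= !muln1 addnC leq_add2r.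
Qed.

Lemma lifts_psi_converse i : psi_at v' i i.+1 -> psi_at v i i.+1.
Proof.
move=> psi U b b0.
have [dz|] := boolP (col_distinct_zeros c U); last first.
  rewrite negb_forall => /existsP[x1]; rewrite negb_forall => /existsP[x2].
  rewrite implybF negbK => /and4P[nx /eqP cx /eqP f1 /eqP f2].
  by apply: (psi_doubled two alt nx cx); rewrite f1.
have [tot|ntot] := eqVneq (tcnt setT U 0) (L + b * (i == 0))%N; last first.
  apply: big1 => Z /andP[/subsetP ZE /eqP cZ]; apply/eqP; apply: contraNT ntot => nz.
  have Zi x : x \in Z -> U x = i by move/ZE; rewrite inE => /eqP.
  have := tcnt_upd setT i.+1 0 Zi; rewrite (zw nz) setTI cZ.
  by rewrite /= muln0 addn0 => <-.
rewrite -(psi_compare (hat_padz U)) ?psi // => i0.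
have [le _] := body_zeros dz; move: tot le qL; rewrite (tcntID tl) -/tl i0 muln1.
by move: (tcnt tl U 0) (tcnt (~: tl) U 0) => u w; lia.
Qed.

End Psi.

End Extension.

(** * Homomorphisms between Specht modules *)

(** Homomorphisms will be related through coefficient functions, without an explicit linear map.
    Partners chosen for a basis are free, because a vanishing combination of them is the partner of
    a vector related to 0. *)
Lemma dim_le_relation (K : fieldType) (vT vT' : vectType K) (U : {vspace vT})
    (U' : {vspace vT'}) (R : vT -> vT' -> Prop) :
    R 0 0 -> (forall a u v u' v', R u u' -> R v v' -> R (a *: u + v) (a *: u' + v')) ->
    (forall u, u \in U -> exists2 u', u' \in U' & R u u') ->
    (forall u, u \in U -> R u 0 -> u = 0) ->
  (\dim U <= \dim U')%N.
Proof.
move=> R0 Rlin Rtot Rinj.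
have ex (i : 'I_(\dim U)) : exists u', u' \in U' /\ R (vbasis U)`_i u'.
  have [|u' U'u' Ru'] := Rtot (vbasis U)`_i; last by exists u'.
  by apply: vbasis_mem; rewrite mem_nth ?size_tuple.
have [f Hf] := fin_all_exists ex.
pose X := [tuple f i | i < \dim U].
have XE (i : 'I_(\dim U)) : X`_i = f i by rewrite -tnth_nth tnth_mktuple.
have Rsum (a : 'I_(\dim U) -> K) :
    R (\sum_i a i *: (vbasis U)`_i) (\sum_i a i *: X`_i).
  elim/big_rec2: _ => [|i u u' _ Ru]; first exact: R0.
  by apply: Rlin => //; rewrite XE; case: (Hf i).
have fX : free X.
  apply/freeP => a e; have := Rsum a; rewrite e => /Rinj H.
  have /freeP := basis_free (vbasisP U); apply; apply: H.
  by apply: memv_suml => i _; rewrite memvZ // vbasis_mem // mem_nth ?size_tuple.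
rewrite -{1}(size_tuple X) -(eqP fX); apply/dimvS/span_subvP => u /mapP[i _ ->].
by case: (Hf i).
Qed.

(** * Homomorphisms out of a cyclic module *)

Section CyclicHom.
Variables (K : fieldType) (gT : finGroupType) (N : nat).
Variable rG : mx_representation K [set: gT] N.

(** A named form of the function inside [homspace], so that a linear structure can be attached to it
    and [linfun] evaluated. *)
Definition hom_defect a b (rU : mx_representation K [set: gT] a)
  (rV : mx_representation K [set: gT] b) g (A : 'M[K]_(a, b)) := rU g *m A - A *m rV g.

Fact hom_defect_is_linear a b rU rV g : linear (@hom_defect a b rU rV g).
Proof.
move=> k A B; rewrite /hom_defect mulmxDr mulmxDl -scalemxAl -scalemxAr scalerBr.
by rewrite opprD addrACA.
Qed.

HB.instance Definition _ a b rU rV g := GRing.isLinear.Build K 'M[K]_(a, b) 'M[K]_(a, b)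
  _ (@hom_defect a b rU rV g) (@hom_defect_is_linear a b rU rV g).

Lemma homspaceP a b (rU : mx_representation K [set: gT] a)
    (rV : mx_representation K [set: gT] b) A :
  reflect (forall g, rU g *m A = A *m rV g) (A \in homspace rU rV).
Proof.
apply: (iffP subv_bigcapP) => [H g|H g _].
  have := H g (in_setT g); rewrite -[linfun _]/(linfun (hom_defect rU rV g)).
  by rewrite -memvE memv_ker lfunE /= subr_eq0 => /eqP.
rewrite -[linfun _]/(linfun (hom_defect rU rV g)) -memvE memv_ker lfunE /=.
by rewrite /hom_defect H subrr.
Qed.

Lemma cyclic_sumP (u v : 'rV[K]_N) : reflect
  (exists a : gT -> K, v = \sum_g a g *: (u *m rG g)) (v <= cyclic_mx rG u)%MS.
Proof.
apply: (iffP cyclic_mxP) => [[A /envelop_mxP[a ->] ->]|[a ->]].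
  exists a; rewrite mulmx_sumr; apply: eq_big => [g|g _]; first by rewrite inE.
  by rewrite -scalemxAr.
exists (\sum_(g in [set: gT]) a g *: rG g); first by apply/envelop_mxP; exists a.
rewrite mulmx_sumr; apply: eq_big => [g|g _]; first by rewrite inE.
by rewrite -scalemxAr.
Qed.

Variables e0 f0 e : 'rV[K]_N.
Hypothesis eU : (e <= cyclic_mx rG e0)%MS.
Hypothesis Ue : (cyclic_mx rG e0 <= cyclic_mx rG e)%MS.

Let U := cyclic_mx rG e0.
Let W := cyclic_mx rG f0.
Let modU : mxmodule rG U := cyclic_mx_module rG e0.
Let modW : mxmodule rG W := cyclic_mx_module rG f0.

Definition hom_image (A : 'M[K]_(\rank U, \rank W)) : 'rV[K]_N :=
  val_submod (in_submod U e *m A).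

Lemma hom_image_linear : linear hom_image.
Proof.
by move=> k A B; rewrite /hom_image mulmxDr -scalemxAr linearP.
Qed.

Lemma hom_image_sub A : (hom_image A <= W)%MS.
Proof. exact: val_submodP. Qed.

(** The matrix on the right extends [A] to the ambient space through [in_submod]; the point is that
    it does not depend on [g]. *)
Lemma hom_image_factor A : A \in homspace (submod_repr modU) (submod_repr modW) ->
  forall g, hom_image A *m rG g = e *m rG g *m val_submod (in_submod U 1%:M *m A).
Proof.
move=> /homspaceP hA g.
rewrite -(val_submodJ modW) ?inE // -mulmxA -[submod_mx modW g]/(submod_repr modW g).
rewrite -hA mulmxA -in_submodJ // in_submodE -mulmxA.
by rewrite !(val_submodE (_ *m _)) !mulmxA.
Qed.

Lemma cyclic_rows m (P : 'M[K]_N) (X : 'M[K]_(m, N)) :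
  (forall g, e *m rG g *m P = 0) -> (X <= cyclic_mx rG e)%MS -> X *m P = 0.
Proof.
move=> H sX; apply/row_matrixP => i; rewrite row_mul row0.
have /cyclic_sumP[a ->] := submx_trans (row_sub i X) sX.
by rewrite mulmx_suml big1 // => g _; rewrite -scalemxAl H scaler0.
Qed.

Lemma hom_image_inj A : A \in homspace (submod_repr modU) (submod_repr modW) ->
  hom_image A = 0 -> A = 0.
Proof.
move=> hA x0; have HB := hom_image_factor hA.
have : (val_submod (1%:M : 'M_(\rank U)) : 'M_(_, N)) *m
         val_submod (in_submod U 1%:M *m A) = 0.
  apply: cyclic_rows; last by apply: submx_trans Ue; apply: val_submodP.
  by move=> g; rewrite -HB x0 mul0mx.
have e1 : val_submod (1%:M : 'M_(\rank U)) *m in_submod U 1%:M = 1%:M.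
  by rewrite -in_submodE val_submodK.
rewrite (val_submodE (_ *m A)) -(mulmxA (in_submod U 1%:M) A) -val_submodE.
rewrite (mulmxA _ (in_submod U 1%:M)) e1 mul1mx => /eqP.
by rewrite val_submod_eq0 => /eqP.
Qed.

(** The homomorphism is the restriction of [B] to U. It is equivariant and lands in W because this
    holds on the translates of [e], which span U. *)
Lemma hom_image_surj x (B : 'M[K]_N) : (x <= W)%MS ->
    (forall g, x *m rG g = e *m rG g *m B) ->
  exists2 A, A \in homspace (submod_repr modU) (submod_repr modW) & hom_image A = x.
Proof.
move=> xW HB.
have xB : e *m B = x by have := HB 1%g; rewrite repr_mx1 !mulmx1.
have sW m (X : 'M[K]_(m, N)) : (X <= cyclic_mx rG e)%MS -> (X *m B <= W)%MS.
  move=> sX; apply/row_subP => i; rewrite row_mul.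
  have /cyclic_sumP[a ->] := submx_trans (row_sub i X) sX.
  rewrite mulmx_suml summx_sub // => g _; rewrite -scalemxAl scalemx_sub // -HB.
  exact: mxmodule_trans.
have eqv m (X : 'M[K]_(m, N)) g : (X <= cyclic_mx rG e)%MS ->
    X *m rG g *m B = X *m B *m rG g.
  move=> sX; apply/eqP; rewrite -subr_eq0 -!mulmxA -mulmxBr; apply/eqP.
  apply: cyclic_rows sX => h; rewrite mulmxBr !mulmxA -[e *m _ *m rG g]mulmxA.
  by rewrite -repr_mxM ?inE // -!HB repr_mxM ?inE // mulmxA subrr.
have s1 : (val_submod (1%:M : 'M_(\rank U)) <= cyclic_mx rG e)%MS.
  by apply: submx_trans Ue; apply: val_submodP.
pose A := in_submod W (val_submod (1%:M : 'M_(\rank U)) *m B).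
have vA : val_submod A = val_submod (1%:M : 'M_(\rank U)) *m B by rewrite in_submodK ?sW.
have vMA m (X : 'M_(m, \rank U)) : val_submod (X *m A) = val_submod X *m B.
  by rewrite (val_submodE (X *m A)) -(mulmxA X A) -val_submodE vA mulmxA -val_submodE.
exists A; last by rewrite /hom_image vMA in_submodK.
apply/homspaceP => g; apply: val_submod_inj.
rewrite (val_submodJ modW) ?inE // vA -eqv // vMA; congr (_ *m B).
by rewrite -(val_submodJ modU) ?inE // mul1mx.
Qed.

End CyclicHom.

Record has_shape (la : seq nat) n (r c : filling n) : Prop := Shape {
  shape_inj : forall x y, r x = r y -> c x = c y -> x = y;
  shape_lt : forall x, (c x < nth 0 la (r x))%N;
  shape_box : forall i j, (j < nth 0 la i)%N -> exists2 x, r x = i & c x = j }.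

Lemma partition_nth_le n la i j : is_partition n la -> (i <= j)%N ->
  (nth 0 la j <= nth 0 la i)%N.
Proof.
move=> /andP[srt _] le; have [lt|ge] := ltnP j (size la); last by rewrite nth_default.
have tr : transitive geq by move=> a b d /= h1 h2; apply: leq_trans h2 h1.
apply: (sorted_leq_nth tr _ 0%N srt) => //; first by move=> a /=.
by rewrite inE; apply: leq_ltn_trans le lt.
Qed.

Lemma shape_diagram n n' la (r c : filling n) : is_partition n' la -> has_shape la r c ->
  diagram r c.
Proof.
move=> pla [inj lt box]; split=> // x k ltk.
  by apply: box; apply: ltn_trans ltk (lt x).
have [|x' rx' cx'] := box k (c x).
  by apply: leq_trans (lt x) _; apply: partition_nth_le pla _; apply: ltnW.
by exists x'.
Qed.

Lemma shape_weight n la (r c : filling n) i : has_shape la r c ->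
  tcnt setT r i = nth 0 la i.
Proof.
move=> [inj lt box]; rewrite tcnt_card; set S := [set x in _ | _].
have rS x : x \in S -> r x = i by rewrite !inE => /eqP.
have [] := @inj_count _ S c (nth 0 la i).
- by move=> x y /rS rx /rS ry; apply: inj; rewrite rx ry.
- by move=> x /rS <-.
move=> le _; apply/eqP; rewrite eqn_leq le /=.
have sub : {subset iota 0 (nth 0 la i) <= map c (enum S)}.
  move=> j; rewrite mem_iota => /box[x rx <-]; apply: map_f.
  by rewrite mem_enum !inE rx eqxx.
by have := uniq_leq_size (iota_uniq _ _) sub; rewrite size_iota size_map -cardE.
Qed.

Lemma shape_perm la n (r c r' c' : filling n) : has_shape la r c -> has_shape la r' c' ->
  exists k, r' = precomp r k /\ c' = precomp c k.
Proof.
move=> [inj lt box] [inj' lt' box'].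
have ex x : exists y, r y = r' x /\ c y = c' x.
  by have [y] := box _ _ (lt' x); exists y.
have [f Hf] := fin_all_exists ex.
have finj : injective f.
  move=> x y e; apply: inj'; first by rewrite -(Hf x).1 -(Hf y).1 e.
  by rewrite -(Hf x).2 -(Hf y).2 e.
exists (perm finj); split; apply/ffunP => x; rewrite ffunE permE; by case: (Hf x).
Qed.

Definition psum (la : seq nat) i : nat := (\sum_(j < i) nth 0 la j)%N.

Lemma psumS la i : psum la i.+1 = (psum la i + nth 0 la i)%N.
Proof. by rewrite /psum big_ord_recr. Qed.

Lemma psum_le la i j : (i <= j)%N -> (psum la i <= psum la j)%N.
Proof.
move=> /subnK <-; elim: (j - i)%N => // k IH; rewrite addSn psumS.
exact: leq_trans IH (leq_addr _ _).
Qed.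

(** [rowof la x] counts the rows that end at or before x, which are exactly the rows above row i. *)
Lemma rowof_eq la x i : (psum la i <= x < psum la i.+1)%N -> rowof la x = i.
Proof.
move=> /andP[le lt].
have lti : (i < size la)%N.
  rewrite ltnNge; apply/negP => ge; move: lt; rewrite psumS nth_default // addn0.
  by rewrite ltnNge le.
rewrite /rowof (eq_bigr (fun j : 'I_(size la) => (j < i)%N : nat)).
  rewrite -big_mkcond /=; have /= -> := @big_ord_narrow _ 0%N addn _ _
    (fun=> 1%N) (ltnW lti).
  by rewrite sum1_card card_ord.
move=> j _; congr nat_of_bool; rewrite -[(\sum_(_ < _) _)%N]/(psum la j.+1).
have [ltj|gej] := ltnP j i; first by rewrite (leq_trans (psum_le la ltj)).
by apply/negbTE; rewrite -ltnNge (leq_trans lt) // psum_le.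
Qed.

Lemma psum_interval la x k : (x < psum la k)%N ->
  exists i, (psum la i <= x < psum la i.+1)%N.
Proof.
elim: k => [|k IH]; first by rewrite /psum big_ord0.
by have [/IH//|ge lt] := ltnP x (psum la k); exists k; rewrite ge.
Qed.

Definition rowfil la n : filling n := [ffun x : 'I_n => rowof la x].
Definition colfil la n : filling n := [ffun x : 'I_n => colof la x].

Lemma initial_shape n la : is_partition n la -> has_shape la (rowfil la n) (colfil la n).
Proof.
move=> /andP[_ /eqP sn].
have psn : psum la (size la) = n.
  by rewrite -sn sumnE (big_nth 0%N) big_mkord.
have row x : (x < n)%N -> (psum la (rowof la x) <= x < psum la (rowof la x).+1)%N.
  by rewrite -psn => /psum_interval[i Hi]; rewrite (rowof_eq Hi).
have colE x : colof la x = (x - psum la (rowof la x))%N by [].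
split=> [x y|x|i j ltj].
- rewrite !ffunE !colE => er ec; apply: val_inj => /=.
  by have := row _ (ltn_ord x); have := row _ (ltn_ord y); rewrite er in ec *; lia.
- by rewrite !ffunE colE; have := row _ (ltn_ord x); rewrite psumS; lia.
- have lti : (i < size la)%N.
    by rewrite ltnNge; apply/negP => ge; rewrite nth_default in ltj.
  have Hi : (psum la i <= psum la i + j < psum la i.+1)%N.
    by rewrite leq_addr psumS ltn_add2l.
  have ltn : (psum la i + j < n)%N.
    by rewrite -psn; case/andP: Hi => _ /leq_trans; apply; apply: psum_le.
  exists (Ordinal ltn); rewrite ffunE /= ?colE (rowof_eq Hi) //.
  by rewrite addKn.
Qed.

Lemma nth_add_first m la i :
  nth 0 (add_first m la) i = (nth 0 la i + m * (i == 0))%N.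
Proof. by case: la i => [|a la] [|i]; rewrite /= ?muln1 ?muln0 ?addn0 ?nth_nil. Qed.

Lemma add_first_partition n m la : is_partition n la ->
  is_partition (n + m) (add_first m la).
Proof.
case: la => [|a la] /andP[srt /eqP <-]; rewrite /is_partition /=; first by rewrite addn0 eqxx.
rewrite addnAC eqxx andbT; case: la srt => //= b la /andP[ab ->]; rewrite andbT.
exact: leq_trans ab (leq_addr _ _).
Qed.

Section AddFirst.
Variables (n m : nat) (mu : seq nat) (r c : filling n).
Hypothesis S : has_shape mu r c.

Definition padcol : filling (n + m) :=
  [ffun x => match split x with inl a => c a | inr y => (nth 0 mu 0 + y)%N end].

Lemma padcolL x : padcol (lshift m x) = c x.
Proof. by rewrite ffunE (unsplitK (inl x)). Qed.

Lemma padcolR y : padcol (rshift n y) = (nth 0 mu 0 + y)%N.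
Proof. by rewrite ffunE (unsplitK (inr y)). Qed.

Lemma add_first_shape : has_shape (add_first m mu) (padz m r) padcol.
Proof.
case: S => inj lt box; split=> [x y|x|i j].
- case: (split_ordP x) => u ->; case: (split_ordP y) => z ->;
    rewrite ?padzL ?padzR ?padcolL ?padcolR => e1 e2.
  + by rewrite (inj _ _ e1 e2).
  + by have := lt u; rewrite e1 e2; lia.
  + by have := lt z; rewrite -e1 -e2; lia.
  + by congr rshift; apply: val_inj => /=; lia.
- rewrite nth_add_first; case: (split_ordP x) => u ->; rewrite ?padzL ?padzR ?padcolL ?padcolR.
    exact: leq_trans (lt u) (leq_addr _ _).
  by rewrite muln1 ltn_add2l.
- rewrite nth_add_first; have [/box[x rx cx] _|ge] := ltnP j (nth 0 mu i).
    by exists (lshift m x); rewrite ?padzL ?padcolL.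
  case: i ge => [|i] ge; rewrite ?muln0 ?muln1; last by rewrite addn0 ltnNge ge.
  move=> ltj; have ltm : (j - nth 0 mu 0 < m)%N by rewrite ltn_subLR.
  by exists (rshift n (Ordinal ltm)); rewrite ?padzR ?padcolR /= ?subnKC.
Qed.

End AddFirst.

(** * Vectors of the tabloid module as functions on fillings *)

Section Coefficients.
Variables (K : fieldType) (n : nat).

Definition rowfun_of (f : filling n) : rowfun n := [ffun x => inord (f x)].
Definition fil_of (t : rowfun n) : filling n := [ffun x => t x : nat].
(** Row functions have values up to n, fillings arbitrary ones, so that entries need no conversion
    between n and n + m. Bounded fillings are those that come from row functions. *)
Definition bounded (f : filling n) := [forall x, f x <= n]%N.

Lemma fil_ofK t : rowfun_of (fil_of t) = t.
Proof. by apply/ffunP => x; rewrite !ffunE inord_val. Qed.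

Lemma rowfun_ofK f : bounded f -> fil_of (rowfun_of f) = f.
Proof. by move=> /forallP b; apply/ffunP => x; rewrite !ffunE inordK // ltnS. Qed.

Lemma bounded_fil_of t : bounded (fil_of t).
Proof. by apply/forallP => x; rewrite ffunE -ltnS. Qed.

Lemma bounded_precomp f g : bounded (precomp f g) = bounded f.
Proof.
apply/forallP/forallP => H x; last by rewrite ffunE.
by have := H (g^-1%g x); rewrite ffunE permKV.
Qed.

Lemma tact_rowfun_of f g : tact (rowfun_of f) g = rowfun_of (precomp f g^-1%g).
Proof. by apply/ffunP => x; rewrite !ffunE. Qed.

Definition vcoef (x : 'rV[K]_(dimW n)) (f : filling n) : K :=
  if bounded f then x 0 (enum_rank (rowfun_of f)) else 0.

Lemma vcoef_linear f : linear (fun x => vcoef x f : K^o).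
Proof.
by move=> a x y; rewrite /vcoef; case: ifP; rewrite ?mxE // scaler0 addr0.
Qed.

Lemma vcoef0 f : vcoef 0 f = 0.
Proof. by rewrite /vcoef mxE if_same. Qed.

Lemma vcoef_sum (I : finType) (P : pred I) (a : I -> K) (x : I -> 'rV[K]_(dimW n)) f :
  vcoef (\sum_(i | P i) a i *: x i) f = \sum_(i | P i) a i * vcoef (x i) f.
Proof.
elim/big_rec2: _ => [|i u v _ <-]; first exact: vcoef0.
by have := vcoef_linear f (a i) (x i) v.
Qed.

Lemma vcoef_inj x y : (forall f, vcoef x f = vcoef y f) -> x = y.
Proof.
move=> H; apply/rowP => i; have := H (fil_of (enum_val i)).
by rewrite /vcoef bounded_fil_of fil_ofK enum_valK.
Qed.

Lemma vcoef_tvec f h : bounded f -> vcoef (tvec K (rowfun_of f)) h = (h == f)%:R.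
Proof.
move=> bf; rewrite /vcoef; case: ifP => bh; last first.
  by case: eqP => // e; rewrite e bf in bh.
rewrite mxE eqxx (inj_eq enum_rank_inj) /=; congr (_%:R); congr nat_of_bool.
by apply/eqP/eqP => [/(congr1 fil_of)|-> //]; rewrite !rowfun_ofK.
Qed.

Lemma tvec_act t g : tvec K t *m tmx K n g = tvec K (tact t g).
Proof.
rewrite /tvec -rowE; apply/rowP => i; rewrite !mxE enum_rankK eqxx /=; congr (_%:R).
by congr nat_of_bool; rewrite -(inj_eq enum_rank_inj) enum_valK eq_sym.
Qed.

Lemma tvec_basis (x : 'rV[K]_(dimW n)) : x = \sum_t x 0 (enum_rank t) *: tvec K t.
Proof.
rewrite {1}(row_sum_delta x) (reindex _ (onW_bij _ (@enum_rank_bij (rowfun n)))) /=.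
by apply: eq_bigr.
Qed.

Lemma vcoef_act x g f : vcoef (x *m tmx K n g) f = vcoef x (precomp f g).
Proof.
rewrite {1 2}(tvec_basis x) mulmx_suml.
under eq_bigr do rewrite -scalemxAl tvec_act.
rewrite !vcoef_sum; apply: eq_bigr => t _; congr (_ * _).
rewrite -{1 2}(fil_ofK t) tact_rowfun_of !vcoef_tvec ?bounded_precomp ?bounded_fil_of //.
congr (_%:R); congr nat_of_bool.
by apply/eqP/eqP => [->|<-]; rewrite -precompM ?mulVg ?mulgV precomp1.
Qed.

Definition vec_of (v : filling n -> K) : 'rV[K]_(dimW n) :=
  \row_i v (fil_of (enum_val i)).

Lemma vcoef_vec_of v f : (forall f, v f != 0 -> bounded f) -> vcoef (vec_of v) f = v f.
Proof.
move=> H; rewrite /vcoef; case: ifP => bf; last first.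
  by apply/esym/eqP; apply: contraFT bf => /H.
by rewrite mxE enum_rankK rowfun_ofK.
Qed.

Variables r c : filling n.

Definition polytabloid : 'rV[K]_(dimW n) :=
  \sum_(s | precomp c s == c) sgp K s *: tvec K (rowfun_of (precomp r s^-1%g)).

Lemma polytabloid_act g : polytabloid *m tmx K n g =
  \sum_(s | precomp c s == c) sgp K s *: tvec K (rowfun_of (precomp r (s * g)^-1%g)).
Proof.
rewrite mulmx_suml; apply: eq_bigr => s _.
by rewrite -scalemxAl tvec_act tact_rowfun_of -precompM invMg.
Qed.

Hypothesis br : bounded r.

Lemma vcoef_polytabloid_act g h : vcoef (polytabloid *m tmx K n g) h =
  \sum_(s | precomp c s == c) sgp K s * (h == precomp r (s * g)^-1%g)%:R.
Proof.
rewrite polytabloid_act vcoef_sum; apply: eq_bigr => s _.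
by rewrite vcoef_tvec ?bounded_precomp.
Qed.

Lemma polytabloid_mulmx g (B : 'M[K]_(dimW n)) j :
  (polytabloid *m tmx K n g *m B) 0 j = \sum_(s | precomp c s == c)
     sgp K s * B (enum_rank (rowfun_of (precomp r (s * g)^-1%g))) j.
Proof.
rewrite polytabloid_act mulmx_suml summxE; apply: eq_bigr => s _.
by rewrite -scalemxAl mxE -rowE mxE.
Qed.

(** The functions [w] supplied for the finitely many bounded fillings are the columns of the
    matrix. *)
Lemma representable_factor x : representable r c (vcoef x) ->
  exists B, forall g, x *m tmx K n g = polytabloid *m tmx K n g *m B.
Proof.
move=> rep.
have [w Hw] := fin_all_exists (fun t : rowfun n => rep (fil_of t)).
exists (\matrix_(i, j) w (enum_val j) (fil_of (enum_val i))) => g.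
apply/rowP => j; rewrite polytabloid_mulmx.
have <- : vcoef (x *m tmx K n g) (fil_of (enum_val j)) = (x *m tmx K n g) 0 j.
  by rewrite /vcoef bounded_fil_of fil_ofK enum_valK.
rewrite vcoef_act Hw; apply: eq_bigr => s _.
by rewrite mxE enum_rankK rowfun_ofK ?bounded_precomp.
Qed.

Lemma factor_representable x B :
  (forall g, x *m tmx K n g = polytabloid *m tmx K n g *m B) ->
  representable r c (vcoef x).
Proof.
move=> H f; have [bf|nbf] := boolP (bounded f); last first.
  exists (fun=> 0) => g; rewrite /vcoef bounded_precomp (negPf nbf) big1 // => s _.
  by rewrite mulr0.
exists (fun t => B (enum_rank (rowfun_of t)) (enum_rank (rowfun_of f))) => g.
by rewrite -vcoef_act H /vcoef bf polytabloid_mulmx.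
Qed.

(** Conjugation by [k] identifies the column stabilisers of the two labellings. *)
Lemma polytabloid_relabel k :
  \sum_(s | precomp (precomp c k) s == precomp c k)
     sgp K s *: tvec K (rowfun_of (precomp (precomp r k) s^-1%g)) =
  polytabloid *m tmx K n k^-1%g.
Proof.
rewrite polytabloid_act (reindex_inj (conjg_inj k^-1%g)) /=.
have e s : (s ^ k^-1 = k * s * k^-1)%g by rewrite conjgE invgK mulgA.
apply: eq_big => [s|s _].
  rewrite -precompM e mulgKV precompM; apply/eqP/eqP => [|-> //].
  by move/(congr1 (fun f => precomp f k^-1%g)); rewrite !precompK.
rewrite odd_permJ -precompM; congr (_ *: tvec K (rowfun_of (precomp r _))).
by rewrite e !invMg invgK -mulgA mulgKV.
Qed.

(* Grouping the permutations [g] by the column tabloid [c o g^-1] exhibits    *)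
(* the vector as a combination of translates of the polytabloid.              *)
Lemma specht_altsum x : (x <= cyclic_mx (tabloid_repr K n) polytabloid)%MS <->
  exists w, forall h, vcoef x h = altsum r c w h.
Proof.
split=> [/cyclic_sumP[a ->]|[w Hw]].
  exists (fun d => \sum_k a k * (sgp K k * (d == precomp c k^-1%g)%:R)) => h.
  rewrite vcoef_sum /altsum.
  under [RHS]eq_bigr do rewrite mulr_sumr.
  rewrite exchange_big /=; apply: eq_bigr => k _.
  rewrite vcoef_polytabloid_act mulr_sumr [RHS](reindex_inj (mulIg k)) /=.
  rewrite big_mkcond [RHS]big_mkcond /=; apply: eq_bigr => s _.
  have -> : (precomp h (s * k)%g == r) = (h == precomp r (s * k)^-1%g).
    by apply/eqP/eqP => [<-|->]; rewrite ?precompK ?precompKV.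
  have -> : (precomp c (s * k)^-1%g == precomp c k^-1%g) = (precomp c s == c).
    rewrite invMg precompM; apply/eqP/eqP => [/(congr1 (fun f => precomp f k))|e].
      by rewrite !precompKV => e; rewrite -{1}e precompKV.
    by rewrite -{1}e precompK.
  case: ifP => _; case: ifP => _; rewrite ?mulr0 // ?mulr1.
  by rewrite sgpM -mulrA [sgp K k * _]mulrC -mulrA mulrCA [_ * sgp K k]mulrC sgp_sqr mulr1.
pose T g := sgp K g *: tvec K (rowfun_of (precomp r g^-1%g)).
have -> : x = \sum_g w (precomp c g^-1%g) *: T g.
  apply: vcoef_inj => h; rewrite Hw vcoef_sum /altsum big_mkcond /=.
  apply: eq_bigr => g _.
  have := vcoef_linear h (sgp K g) (tvec K (rowfun_of (precomp r g^-1%g))) 0.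
  rewrite addr0 vcoef0 addr0 => ->; rewrite vcoef_tvec ?bounded_precomp //.
  have -> : (precomp h g == r) = (h == precomp r g^-1%g).
    by apply/eqP/eqP => [<-|->]; rewrite ?precompK ?precompKV.
  by case: eqP => _; rewrite /GRing.scale /= ?mulr0 ?mulr1 // mulrC.
pose cl g := [set g' | precomp c g'^-1%g == precomp c g^-1%g].
rewrite (partition_big cl xpredT) //=; apply: summx_sub => Q _.
have [g0 /eqP eQ|no] := pickP (fun g => cl g == Q); last first.
  by rewrite big_pred0 ?sub0mx // => g; rewrite no.
have clE g : (cl g == Q) = (precomp c g^-1%g == precomp c g0^-1%g).
  rewrite -eQ; apply/eqP/eqP => [/setP/(_ g)|e]; last by apply/setP => g'; rewrite !inE e.
  by rewrite !inE eqxx => /esym/eqP.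
rewrite (eq_bigl _ _ clE) (eq_bigr (fun g => w (precomp c g0^-1%g) *: T g)); last first.
  by move=> g /eqP ->.
rewrite -scaler_sumr scalemx_sub //.
have -> : \sum_(g | precomp c g^-1%g == precomp c g0^-1%g) T g =
    sgp K g0 *: (polytabloid *m tmx K n g0).
  rewrite polytabloid_act scaler_sumr (reindex_inj (mulIg g0)) /=.
  apply: eq_big => [s|s _]; last by rewrite /T sgpM scalerA [sgp K g0 * _]mulrC.
  rewrite invMg precompM; apply/eqP/eqP => [/(congr1 (fun f => precomp f g0))|e].
    by rewrite !precompKV => e; rewrite -{1}e precompKV.
  by rewrite -{1}e precompK.
apply: scalemx_sub; apply: (@mxmodule_trans _ _ _ _ (tabloid_repr K n) _ _ _ _ g0).
- exact: cyclic_mx_module.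
- by rewrite inE.
- exact: cyclic_mx_id.
Qed.

End Coefficients.

Lemma shape_bounded n n' la (r c : filling n) : is_partition n' la -> has_shape la r c ->
  bounded r.
Proof.
move=> pla S; apply/forallP => x; apply: ltnW.
exact: diagram_row_bound (shape_diagram pla S).
Qed.

(** * The kernel intersection theorem *)

Section Kernel.
Variables (K : fieldType) (n n' : nat) (la : seq nat) (r c : filling n).
Hypotheses (two : (2%:R : K) != 0) (pla : is_partition n' la) (S : has_shape la r c).

Lemma weight_precomp (f : filling n) : (forall a, tcnt setT f a = nth 0 la a) ->
  exists g, precomp f g = r.
Proof.
move=> H; have [|a|g _ e] := @tcnt_perm_ex _ setT f r; last by exists g.
  by move=> x; rewrite inE.
by rewrite H (shape_weight _ S).
Qed.

Lemma weight_bounded (f : filling n) : (forall a, tcnt setT f a = nth 0 la a) -> bounded f.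
Proof.
move=> /weight_precomp[g e]; rewrite -(bounded_precomp f g) e.
exact: shape_bounded pla S.
Qed.

(** James's theorem, obtained from [altsum_psi] and [psi_altsum] for the transposed diagram; the
    weight condition says that the support consists of rearrangements of [r]. *)
Lemma specht_kernel x : (x <= cyclic_mx (tabloid_repr K n) (polytabloid K r c))%MS <->
  (forall i, psi_at (vcoef x) i i.+1) /\
  (forall f, vcoef x f != 0 -> forall a, tcnt setT f a = nth 0 la a).
Proof.
have br := shape_bounded pla S.
have D := diagram_sym (shape_diagram pla S).
split=> [/(specht_altsum c br)[w Hw]|[psi supp]].
  split=> [i U b b0|f nz a].
    rewrite (eq_bigr (fun Z : {set 'I_n} => altsum r c w (upd U Z i.+1))) //.
    exact: (altsum_psi two D).
  have [g /eqP e|no] := pickP (fun g => precomp f g == r).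
    by rewrite -(shape_weight a S) -e tcnt_perm ?perm_onT.
  by move: nz; rewrite Hw /altsum big_pred0 ?eqxx.
apply/(specht_altsum c br); apply: (psi_altsum two D psi) => f /supp.
exact: weight_precomp.
Qed.

End Kernel.

Lemma polytab_polytabloid (K : fieldType) la n :
  polytab K la n = polytabloid K (rowfil la n) (colfil la n).
Proof.
apply: eq_big => [s|s _].
  rewrite inE; apply/forallP/eqP => [H|/ffunP H x].
    by apply/ffunP => x; rewrite !ffunE; apply/eqP.
  by have := H x; rewrite !ffunE => ->.
congr (_ *: tvec K _); apply/ffunP => x; by rewrite !ffunE.
Qed.

(** Two labellings of one shape differ by a permutation, so their polytabloids are translates of
    each other. *)
Lemma specht_generator (K : fieldType) la n (r c : filling n) :
    is_partition n la -> has_shape la r c ->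
  (polytabloid K r c <= specht_mx K la n)%MS /\
  (specht_mx K la n <= cyclic_mx (tabloid_repr K n) (polytabloid K r c))%MS.
Proof.
move=> pla S; have S0 := initial_shape pla.
have [k [-> ->]] := shape_perm S0 S.
set e0 := polytabloid K (rowfil la n) (colfil la n).
have e0E : e0 = polytab K la n by rewrite polytab_polytabloid.
have eE : polytabloid K (precomp (rowfil la n) k) (precomp (colfil la n) k) =
    e0 *m tabloid_repr K n k^-1%g by exact: polytabloid_relabel.
rewrite /specht_mx -e0E eE; split.
  by rewrite mxmodule_trans ?cyclic_mx_module ?cyclic_mx_id ?inE.
apply: cyclic_mx_sub; first exact: cyclic_mx_module.
rewrite -[X in (X <= _)%MS](repr_mxK (tabloid_repr K n) (in_setT k^-1%g)) invgK.
by rewrite mxmodule_trans ?cyclic_mx_module ?cyclic_mx_id ?inE.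
Qed.

(* The coefficient functions of the images of the polytabloid of (r, c) under *)
(* the homomorphisms from S^mu to S^la, where (r, c) has shape mu.                *)
Definition hom_coefficients (K : fieldType) n (la : seq nat) (r c : filling n)
    (v : filling n -> K) : Prop :=
  [/\ representable r c v, forall i, psi_at v i i.+1 &
      forall f, v f != 0 -> forall a, tcnt setT f a = nth 0 la a].

(** * Homomorphisms of Specht modules as coefficient functions *)

Section SpechtHom.
Variables (K : fieldType) (n : nat) (mu la : seq nat) (r c : filling n).
Hypotheses (two : (2%:R : K) != 0) (pmu : is_partition n mu) (pla : is_partition n la).
Hypothesis S : has_shape mu r c.

Let eU := (specht_generator K pmu S).1.
Let Ue := (specht_generator K pmu S).2.

Definition hom_coef (A : 'M[K]_(\rank (specht_mx K mu n), \rank (specht_mx K la n))) :=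
  vcoef (hom_image (polytabloid K r c) A).

Lemma hom_coef_linear a A B f :
  hom_coef (a *: A + B) f = a * hom_coef A f + hom_coef B f.
Proof. by rewrite /hom_coef hom_image_linear; apply: vcoef_linear. Qed.

Lemma hom_coef0 f : hom_coef 0 f = 0.
Proof.
have := hom_coef_linear (-1) 0 0 f; rewrite scaler0 addr0 => ->.
by rewrite mulN1r addNr.
Qed.

Lemma hom_coef_inj A : A \in homspace (specht K mu n) (specht K la n) ->
  (forall f, hom_coef A f = 0) -> A = 0.
Proof.
move=> hA H; apply: (hom_image_inj eU Ue hA); apply: vcoef_inj => f.
by rewrite vcoef0; apply: H.
Qed.

Lemma specht_kernel0 x : (x <= specht_mx K la n)%MS <->
  (forall i, psi_at (vcoef x) i i.+1) /\
  (forall f, vcoef x f != 0 -> forall a, tcnt setT f a = nth 0 la a).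
Proof.
rewrite /specht_mx polytab_polytabloid.
exact: (specht_kernel two pla (initial_shape pla)).
Qed.

Lemma hom_coefP A : A \in homspace (specht K mu n) (specht K la n) ->
  hom_coefficients la r c (hom_coef A).
Proof.
move=> hA; have /specht_kernel0[psi supp] := hom_image_sub (polytabloid K r c) A.
split=> //; apply: factor_representable (hom_image_factor eU hA).
Qed.

(** The weight makes [v] the coefficient function of a vector, the exchange conditions place this
    vector in S^la, and representability supplies the matrix that [hom_image_surj] restricts to
    S^mu. *)
Lemma hom_coef_surj v : hom_coefficients la r c v ->
  exists2 A, A \in homspace (specht K mu n) (specht K la n) & forall f, hom_coef A f = v f.
Proof.
case=> rep psi supp.
have bd f : v f != 0 -> bounded f.
  by move=> /supp; apply: (weight_bounded pla (initial_shape pla)).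
have vE f : vcoef (vec_of v) f = v f by apply: vcoef_vec_of.
have rep' : representable r c (vcoef (vec_of v)).
  by move=> f; have [w Hw] := rep f; exists w => g; rewrite vE.
have [B HB] := representable_factor (shape_bounded pmu S) rep'.
have xW : (vec_of v <= specht_mx K la n)%MS.
  apply/specht_kernel0; split=> [i U b b0|f]; last by rewrite vE; apply: supp.
  by under eq_bigr do rewrite vE; apply: psi.
have [A hA xA] := hom_image_surj eU Ue xW HB.
by exists A => // f; rewrite /hom_coef xA vE.
Qed.

End SpechtHom.

Local Close Scope ring_scope.

Theorem theorem1p1 (K : fieldType) (p : nat)
    (Kinf : forall s : seq K, exists x : K, x \notin s)
    (pprime : prime p) (charK : (p \in [pchar K])%R) (p_gt2 : (2 < p)%N)
    (n : nat) (la mu : seq nat)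
    (la_part : is_partition n la) (mu_part : is_partition n mu)
    (k d : nat) (k_gt0 : (0 < k)%N) (d_gt0 : (0 < d)%N)
    (hpd : (minn (nth 0 la 1) (nth 0 mu 0 - nth 0 la 0) < p ^ d)%N)
    (hmu2 : (nth 0 mu 1 <= nth 0 la 0)%N) :
  dimHom K n mu la =
  dimHom K (n + k * p ^ d) (add_first (k * p ^ d) mu) (add_first (k * p ^ d) la).
Proof.
have two : (2%:R != 0 :> K)%R.
  by rewrite -(dvdn_pcharf charK) gtnNdvd.
set m := (k * p ^ d)%N.
have binP0 t w : (w < p ^ d)%N -> ('C(t + m, w)%:R = 'C(t, w)%:R :> K)%R.
  exact: bin_add_pexp.
set r := rowfil mu n; set c := colfil mu n.
set r' := padz m r; set c' := padcol m mu c.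
have S : has_shape mu r c := initial_shape mu_part.
have S' : has_shape (add_first m mu) r' c' := add_first_shape m S.
have pmu' := add_first_partition m mu_part.
have pla' := add_first_partition m la_part.
have D := shape_diagram mu_part S.
have D' := shape_diagram pmu' S'.
have r'L x : r' (lshift m x) = r x := padzL m r x.
have r'R y : r' (rshift n y) = 0%N := padzR r y.
have c'L x : c' (lshift m x) = c x := padcolL m mu c x.
have c'R y : c' (rshift n y) = (nth 0 mu 0 + y)%N := padcolR mu c y.
have qM : (nth 0 mu 1 <= nth 0 mu 0)%N := partition_nth_le mu_part (leq0n 1).
have tail_row x : (nth 0 mu 1 <= c x)%N -> r x = 0%N.
  move=> le; apply/eqP; rewrite -leqn0 leqNgt; apply/negP => r0.
  have := leq_ltn_trans le (shape_lt S x).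
  by rewrite ltnNge (partition_nth_le mu_part r0).
have cM x : (c x < nth 0 mu 0)%N.
  exact: leq_trans (shape_lt S x) (partition_nth_le mu_part (leq0n _)).
have la'E a : nth 0 (add_first m la) a = (nth 0 la a + m * (a == 0))%N := nth_add_first m la a.
have lifted (v : filling n -> K) : hom_coefficients la r c v -> exists2 v',
    hom_coefficients (add_first m la) r' c' v' & forall f, v' (padz m f) = v f.
  case=> rep psi supp.
  have zw : zero_weight (nth 0 la 0) v by move=> f /supp.
  have sym := representable_symmetric_on two D (tail_inj D tail_row) rep.
  have lf := lifts_ext c'L c'R qM sym.
  exists (ext (nth 0 mu 1) c' v); last first.
    by move=> f; have [l1 _] := lf; apply: l1; apply: hat_padz c'L c'R qM f.
  split=> [|i|f nz a].
  - exact: (lifts_representable two D D' r'L r'R c'L c'R qM hmu2 tail_row rep zw lf).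
  - apply: (lifts_psi two D D' r'L r'R c'L c'R qM hmu2 tail_row cM binP0 hpd rep lf zw).
      by move=> f /supp.
    exact: psi.
  - have [fh hf nzh] := lifts_supp c'L c'R qM lf nz.
    by rewrite (tcnt_hat c'L c'R qM a hf) (supp _ nzh) la'E.
have restricted (v' : filling (n + m) -> K) : hom_coefficients (add_first m la) r' c' v' ->
    lifts (nth 0 mu 1) c c' (fun f => v' (padz m f)) v' /\
    hom_coefficients la r c (fun f => v' (padz m f)).
  case=> rep' psi' supp'.
  have supp f : (v' (padz m f) != 0)%R -> forall a, tcnt setT f a = nth 0 la a.
    move=> nz a; have := tcnt_hat c'L c'R qM a (hat_padz c'L c'R qM f).
    by rewrite (supp' _ nz) la'E => /eqP; rewrite eqn_add2r => /eqP.
  have zw : zero_weight (nth 0 la 0) (fun f => v' (padz m f)) by move=> f /supp.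
  have rep := res_representable D' r'L r'R c'L c'R qM tail_row rep'.
  have lf : lifts (nth 0 mu 1) c c' (fun f => v' (padz m f)) v'.
    apply: (lifts_res two D' r'L r'R c'L c'R qM hmu2 tail_row rep').
    by move=> f /supp' ->; rewrite la'E muln1.
  split=> //; split=> // i.
  apply: (lifts_psi_converse two D c'L c'R qM hmu2 tail_row cM binP0 hpd rep lf zw) => //.
  by move=> f /supp.
(* Restriction to padded fillings, as a relation. It is total from the smaller side by [lifted] and
   from the larger side by [restricted]. *)
pose R (A : 'M[K]_(\rank (specht_mx K mu n), \rank (specht_mx K la n)))
  (A' : 'M[K]_(\rank (specht_mx K (add_first m mu) (n + m)),
               \rank (specht_mx K (add_first m la) (n + m)))) :=
  forall f, hom_coef r c A f = hom_coef r' c' A' (padz m f).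
have R0 : R 0%R 0%R by move=> f; rewrite !hom_coef0.
have Rlin a A B A' B' : R A A' -> R B B' -> R (a *: A + B)%R (a *: A' + B')%R.
  by move=> RA RB f; rewrite !hom_coef_linear RA RB.
apply/eqP; rewrite eqn_leq; apply/andP; split.
  apply: (@dim_le_relation _ _ _ _ _ R) => // [A hA|A hA RA].
    have [v' hv' v'E] := lifted _ (hom_coefP two mu_part la_part S hA).
    have [A' hA' A'E] := hom_coef_surj two pmu' pla' S' hv'.
    by exists A' => // f; rewrite A'E v'E.
  by apply: (hom_coef_inj mu_part S hA) => f; rewrite RA hom_coef0.
apply: (@dim_le_relation _ _ _ _ _ (fun A' A => R A A')) => // [a A B A' B'|A' hA'|A' hA' RA].
- exact: Rlin.
- have [lf hv] := restricted _ (hom_coefP two pmu' pla' S' hA').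
  have [A hA AE] := hom_coef_surj two mu_part la_part S hv.
  by exists A.
- have [lf _] := restricted _ (hom_coefP two pmu' pla' S' hA').
  (* A non-zero value of the larger function equals a value of its restriction, which vanishes
     here. *)
  apply: (hom_coef_inj pmu' S' hA') => f; apply/eqP; apply/negPn/negP => nz.
  have [fh _ ] := lifts_supp c'L c'R qM lf nz.
  by rewrite -RA hom_coef0 eqxx.
Qed.
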